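(* Let $n\ge 2$ and let $P$ be a nonzero homogeneous harmonic polynomial of degree $N$ on $\mathbb{R}^n$. Then its Laplace transform $$\widehat P(\rho)=\int_{x>0}e^{-x\cdot\rho}P(x)\,dx$$ is given by $\widehat P(\rho)=Q^{N+n}\big(\tfrac1\rho\big)$ for a homogeneous polynomial $Q^{N+n}$ of degree $N+n$ in the reciprocals of the transform variables. Moreover: - if $n\ge3$, $\widehat P$ cannot vanish identically on any nonempty open subset of the variety $\{\rho\in\mathbb{C}^n:\rho\cdot\rho=0\}$; - if $n=2$, $\widehat P$ cannot vanish identically on both a nonempty open subset of $\{\rho_1=i\rho_2\}$ and a nonempty open subset of $\{\rho_1=-i\rho_2\}$.
   Context: $x>0$ means every component of $x\in\mathbb{R}^n$ is positive; $\tfrac1\rho=(\tfrac1{\rho_1},\dots,\tfrac1{\rho_n})$; $\rho\cdot\rho=\sum_j\rho_j^2$ and $x\cdot\rho=\sum_j x_j\rho_j$ (bilinear). The integral converges when $\operatorname{Re}\rho_j>0$ for all $j$; elsewhere (for $\rho\in\mathbb{C}^n$ with all components nonzero) $\widehat P(\rho)$ denotes the rational function $Q^{N+n}(1/\rho)$. ''Open subset'' of a variety means relatively open; vanishing is understood at the points with all components nonzero. Polynomials may have complex coefficients. *)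

(* Defs.v *)
From HB Require Import structures.
From mathcomp Require Import all_boot all_order all_algebra.
(* [mpoly] has to be imported before MathComp-Analysis: in the other order its
   notations are rejected. *)
From mathcomp Require Import mpoly.
From mathcomp Require Import complex.
From mathcomp Require Import all_classical all_reals all_analysis.

Set Implicit Arguments.
Unset Strict Implicit.
Unset Printing Implicit Defensive.

Import Order.TTheory GRing.Theory Num.Theory.
Import numFieldNormedType.Exports.

Local Open Scope classical_set_scope.
Local Open Scope ring_scope.
Local Open Scope complex_scope.

Section product_measure_power.
Context d (T : measurableType d) (R : realType).
Variable m : {sigma_finite_measure set T -> \bar R}.

Definition cons_pair n (p : T * n.-tuple T) : n.+1.-tuple T :=
  [tuple of p.1 :: p.2].

Definition uncons_pair n (t : n.+1.-tuple T) : T * n.-tuple T :=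
  (thead t, [tuple of behead t]).

Lemma cons_pairK n : cancel (@cons_pair n) (@uncons_pair n).
Proof.
move=> [x t]; rewrite /uncons_pair /cons_pair /= theadE.
by congr (_, _); exact/val_inj.
Qed.

Lemma measurable_cons_pair n : measurable_fun [set: _] (@cons_pair n).
Proof. exact: measurable_cons. Qed.

Lemma measurable_uncons_pair n : measurable_fun [set: _] (@uncons_pair n).
Proof.
apply: measurable_fun_pair; first exact: measurable_tnth.
exact: measurable_behead.
Qed.

Section step.
Variables (n : nat) (mu : {sigma_finite_measure set (n.-tuple T) -> \bar R}).

Definition measure_cons : set (n.+1.-tuple T) -> \bar R :=
  pushforward (m \x mu)%E (@cons_pair n).

Let measure_cons0 : measure_cons set0 = 0%E.
Proof. by rewrite /measure_cons /pushforward preimage_set0 measure0. Qed.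

Let measure_cons_ge0 A : (0 <= measure_cons A)%E.
Proof. by rewrite /measure_cons /pushforward; exact: measure_ge0. Qed.

Let measure_cons_sigma_additive : semi_sigma_additive measure_cons.
Proof.
move=> F mF tF mUF; rewrite /measure_cons /pushforward preimage_bigcup.
apply: measure_semi_sigma_additive.
- by move=> k; rewrite -[X in measurable X]setTI; exact: measurable_cons_pair.
- apply/trivIsetP => /= i j _ _ ij; rewrite -preimage_setI.
  by move/trivIsetP : tF => /(_ _ _ _ _ ij) ->//; rewrite preimage_set0.
- rewrite -preimage_bigcup -[X in measurable X]setTI.
  exact: measurable_cons_pair.
Qed.

HB.instance Definition _ := isMeasure.Build _ _ _ measure_cons
  measure_cons0 measure_cons_ge0 measure_cons_sigma_additive.

Let measure_cons_sigma_finite : sigma_finite setT measure_cons.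
Proof.
have /sigma_finiteP[F [TF ndF Foo]] := sigma_finiteT m.
have /sigma_finiteP[G [TG ndG Goo]] := sigma_finiteT mu.
exists (fun k => @uncons_pair n @^-1` (F k `*` G k)).
  rewrite -preimage_bigcup [X in _ @^-1` X](_ : _ = setT) ?preimage_setT//.
  apply/seteqP; split=> // -[x y] _.
  have [i _ Fx] : (\bigcup_k F k) x by rewrite -TF.
  have [j _ Gy] : (\bigcup_k G k) y by rewrite -TG.
  exists (maxn i j) => //; split => /=.
  - by move: x Fx; exact/subsetPset/ndF/leq_maxl.
  - by move: y Gy; exact/subsetPset/ndG/leq_maxr.
move=> k; have [mF Foo'] := Foo k; have [mG Goo'] := Goo k.
have mFG : measurable (F k `*` G k) by exact: measurableX.
split; first by rewrite -[X in measurable X]setTI; exact: measurable_uncons_pair.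
rewrite /measure_cons /pushforward -comp_preimage.
rewrite (_ : _ \o _ = id) ?preimage_id; last first.
  by apply/funext => p; rewrite /= cons_pairK.
by rewrite product_measure1E// lte_mul_pinfty// ge0_fin_numE.
Qed.

HB.instance Definition _ := Measure_isSigmaFinite.Build _ _ _ measure_cons
  measure_cons_sigma_finite.

End step.

(* The [n]-fold product measure of [m], transported along T * T^n ~ T^(n+1);
   T^0 is a point of mass 1. *)
Fixpoint measure_power (n : nat)
    : {sigma_finite_measure set (n.-tuple T) -> \bar R} :=
  match n with
  | 0 => dirac ([tuple] : 0.-tuple T)
  | k.+1 => measure_cons (measure_power k)
  end.

End product_measure_power.

Definition lebesgue_measure_rn (R : realType) (n : nat)
    : {sigma_finite_measure set (n.-tuple (measurableTypeR R)) -> \bar R} :=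
  measure_power (@lebesgue_measure R) n.

Section complex_integral.
Context d (T : measurableType d) (R : realType).
Variable mu : {measure set T -> \bar R}.

Definition cintegrable (D : set T) (f : T -> R[i]) : Prop :=
  mu.-integrable D (fun x => (complex.Re (f x))%:E) /\
  mu.-integrable D (fun x => (complex.Im (f x))%:E).

Definition cintegral (D : set T) (f : T -> R[i]) : R[i] :=
  (\int[mu]_(x in D) complex.Re (f x)) +i* (\int[mu]_(x in D) complex.Im (f x)).

End complex_integral.

Section laplace.
Variable R : realType.

Definition cexp (z : R[i]) : R[i] :=
  (expR (complex.Re z) * cos (complex.Im z))
    +i* (expR (complex.Re z) * sin (complex.Im z)).

Definition harmonic_mpoly (n : nat) (P : {mpoly R[i][n]}) : Prop :=
  \sum_(j < n) P^`M(j)^`M(j) = 0.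

Definition positive_orthant (n : nat) : set (n.-tuple (measurableTypeR R)) :=
  [set x | forall j : 'I_n, 0 < tnth x j].

Definition laplace_integrand (n : nat) (P : {mpoly R[i][n]}) (rho : 'rV[R[i]]_n)
    (x : n.-tuple (measurableTypeR R)) : R[i] :=
  cexp (- \sum_(j < n) (tnth x j)%:C * rho 0 j)
    * P.@[fun j => (tnth x j)%:C].

Definition laplace_converges (n : nat) (P : {mpoly R[i][n]}) (rho : 'rV[R[i]]_n)
    : Prop :=
  cintegrable (lebesgue_measure_rn R n) (@positive_orthant n) (laplace_integrand P rho).

Definition laplace (n : nat) (P : {mpoly R[i][n]}) (rho : 'rV[R[i]]_n) : R[i] :=
  cintegral (lebesgue_measure_rn R n) (@positive_orthant n) (laplace_integrand P rho).

(* Q(1/rho) *)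
Definition eval_inv (n : nat) (Q : {mpoly R[i][n]}) (rho : 'rV[R[i]]_n) : R[i] :=
  Q.@[fun j => (rho 0 j)^-1].

Definition isotropic_cone (n : nat) : set 'rV[R[i]]_n :=
  [set rho | \sum_(j < n) rho 0 j ^+ 2 = 0].

(* rho_1 = s * rho_2, for n = 2; the coordinates are numbered from 0. *)
Definition coordinate_line (n : nat) (s : R[i]) : set 'rV[R[i]]_n :=
  [set rho | forall j k : 'I_n,
     j = 0%N :> nat -> k = 1%N :> nat -> rho 0 j = s * rho 0 k].

(* [R[i]] has no topology of its own; its copy [R[i]^o] carries the norm one. *)
Definition relatively_open (n : nat) (V W : set 'rV[R[i]]_n) : Prop :=
  exists2 U : set 'rV[R[i]^o]_n, open U & W = U `&` V.

(* Q(1/rho) has no meaning where some component of rho is zero (there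
   0^-1 = 0), so such points are disregarded. *)
Definition vanishes_on (n : nat) (f : 'rV[R[i]]_n -> R[i]) (W : set 'rV[R[i]]_n)
    : Prop :=
  forall rho, W rho -> (forall j, rho 0 j != 0) -> f rho = 0.

End laplace.

(* Main.v *)
(** Idea. Since the integral of x^k exp(- x rho) over x > 0 is k! / rho^(k+1), the transform of
    P is Q(1/rho), where Q is P with each monomial x^m replaced by m! x^(m+1). Clearing
    denominators gives S(rho) = (rho_1 ... rho_n)^(M+1) Q(1/rho), a polynomial for M = N + 1,
    which vanishes where some rho_j does. If Q(1/rho) vanishes on an open piece of the cone, then
    S vanishes on the whole cone, because any two points of the cone lie on a rational curve
    (a conic) contained in it; hence S = (rho.rho) T. Transforming back, multiplication by
    rho.rho becomes the Laplacian, so P = Laplacian U where U comes from T. The degree of T in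
    each rho_j is at most M - 2, so every monomial of U has all its exponents >= 2, say
    U = x_1^2 x_2^2 V, and U is biharmonic. So U has components of degrees N + 2 and N only in the
    decomposition into harmonic polynomials on the sphere, those of V have degree <= N - 2, and
    orthogonality gives 0 = <U, V> = |x_1 x_2 V|^2 for the Gaussian inner product. The latter is
    expressed algebraically as the Fischer inner product of exp(Laplacian / 2) f and
    exp(Laplacian / 2) g. *)

From HB Require Import structures.
Require Import Defs.
From mathcomp Require Import all_boot all_order all_algebra.
From mathcomp Require Import ssrcomplements mpoly.
From mathcomp Require Import complex ring lra zify.
From mathcomp Require Import all_classical all_reals all_analysis.
From mathcomp Require Import measurable_realfun.

Set Implicit Arguments.
Unset Strict Implicit.
Unset Printing Implicit Defensive.

Import Order.TTheory GRing.Theory Num.Theory.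
Import numFieldNormedType.Exports.

Local Open Scope classical_set_scope.
Local Open Scope ring_scope.
Local Open Scope complex_scope.

(** * The Laplacian on polynomials *)

Definition mfact n (m : 'X_{1..n}) : nat := \prod_(i < n) (m i)`!.

Lemma mfact_gt0 n (m : 'X_{1..n}) : (0 < mfact m)%N.
Proof. by apply: prodn_gt0 => i; exact: fact_gt0. Qed.

Lemma mfactDU n (m : 'X_{1..n}) (j : 'I_n) :
  mfact (m + U_(j)) = ((m j).+1 * mfact m)%N.
Proof.
rewrite /mfact (bigD1 j) //= [in RHS](bigD1 j) //= mnmDE mnm1E eqxx addn1 factS -mulnA.
congr (_ * (_ * _))%N; apply: eq_bigr => i ij.
by rewrite mnmDE mnm1E eq_sym (negbTE ij) addn0.
Qed.

Section MonomialMul.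
Variables (n : nat) (R : nzRingType).
Implicit Types (p : {mpoly R[n]}) (m k : 'X_{1..n}).

Lemma mcoeffMX_eq0 p m k : ~~ (m <= k)%MM -> (p * 'X_[m])@_k = 0.
Proof.
move=> mk; apply/memN_msupp_eq0; rewrite (perm_mem (msuppMX p m)).
by apply: contra mk => /mapP[l _ ->]; exact: lem_addr.
Qed.

Lemma mcoeffMX_sub p m k : (m <= k)%MM -> (p * 'X_[m])@_k = p@_(k - m).
Proof. by move=> mk; rewrite -{1}(submK mk) addmC mcoeffMX. Qed.

End MonomialMul.

Section Laplacian.
Variables (n : nat) (C : comNzRingType).
Implicit Types (f g : {mpoly C[n]}) (m : 'X_{1..n}).

Definition laplacian f : {mpoly C[n]} := \sum_(j < n) f^`M(j)^`M(j).

Lemma laplacian_is_linear : linear laplacian.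
Proof.
move=> c f g; rewrite /laplacian scaler_sumr -big_split; apply: eq_bigr => j _ /=.
by rewrite !linearP.
Qed.

HB.instance Definition _ := GRing.isLinear.Build C {mpoly C[n]} {mpoly C[n]} _
  laplacian laplacian_is_linear.

Lemma mcoeff_laplacian f m : (laplacian f)@_m =
  \sum_(j < n) f@_(m + U_(j) + U_(j)) *+ ((m j).+1 * (m j).+2).
Proof.
rewrite raddf_sum; apply: eq_bigr => j _ /=.
by rewrite !mcoeff_mderiv mnmDE mnm1E eqxx addn1 -mulrnA mulnC.
Qed.

Lemma mderiv_laplacian j f : (laplacian f)^`M(j) = laplacian f^`M(j).
Proof.
rewrite linear_sum; apply: eq_bigr => i _ /=.
by rewrite (mderiv_comm i j) (mderiv_comm i j).
Qed.

Lemma laplacian_mulX j f :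
  laplacian ('X_j * f) = 'X_j * laplacian f + f^`M(j) *+ 2.
Proof.
rewrite /laplacian mulr_sumr (bigD1 j) //= [in RHS](bigD1 j) //=.
have XU i : ('X_j : {mpoly C[n]})^`M(i) = (i == j)%:R.
  rewrite mderivX mnm1E eq_sym; case: eqP => [->|_]; last by rewrite scale0r.
  by rewrite -{1}[U_(j)%MM]add0m addmK scale1r mpolyX0.
rewrite (eq_bigr (fun i => 'X_j * f^`M(i)^`M(i))); last first.
  by move=> i /negbTE ij; rewrite mderivM XU ij mul0r add0r mderivM XU ij mul0r add0r.
rewrite mderivM XU eqxx mul1r mderivD mderivM XU eqxx mul1r.
by ring.
Qed.

(** The commutator of the Laplacian with ['X_j] is twice the derivation along [j], which commutes
    with the Laplacian; iterating gives the factor [2 * k.+1]. *)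
Lemma iter_laplacian_mulX k j f : iter k.+1 laplacian ('X_j * f) =
  'X_j * iter k.+1 laplacian f + (iter k laplacian f)^`M(j) *+ (2 * k.+1).
Proof.
elim: k => [|k IH]; first by rewrite /= laplacian_mulX muln1.
rewrite iterS IH raddfD raddfMn /= laplacian_mulX -mderiv_laplacian -addrA -mulrnDr.
by congr (_ + _ *+ _); lia.
Qed.

(** The Laplacian lowers degrees by two; counting only one degree per application already suffices
    for truncating the heat series and for reading off its leading term. *)
Lemma mcoeff_iter_laplacian_eq0 k f m :
  (msize f <= mdeg m + k)%N -> (iter k laplacian f)@_m = 0.
Proof.
elim: k m => [|k IH] m fm.
  by apply/memN_msupp_eq0/msize_mdeg_ge; rewrite -(addn0 (mdeg m)).
rewrite /= mcoeff_laplacian big1 // => j _; rewrite IH ?mul0rn //.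
by rewrite !mdegD mdeg1; lia.
Qed.

Lemma iter_laplacian_eq0 k f : (msize f <= k)%N -> iter k laplacian f = 0.
Proof.
move=> fk; apply/mpolyP => m; rewrite mcoeff0.
by apply: mcoeff_iter_laplacian_eq0; apply: leq_trans fk (leq_addl _ _).
Qed.

End Laplacian.

(** * The Fischer inner product *)

Section Fischer.
Variables (n : nat) (C : numClosedFieldType).
Implicit Types (f g : {mpoly C[n]}) (m : 'X_{1..n}).

(** The argument in which the form is linear comes last, so that [fischer g] is a linear map; the
    form is conjugate-linear in [g]. *)
Definition fischer g f : C :=
  \sum_(m <- msupp f) f@_m * (g@_m)^* * (mfact m)%:R.

Lemma fischerwE k g f : (msize f <= k)%N -> fischer g f =
  \sum_(m : 'X_{1..n < k}) f@_m * (g@_m)^* * (mfact m)%:R.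
Proof.
move=> fk; pose I : subFinType _ := 'X_{1..n < k}.
rewrite /fischer (big_mksub I) /=; last 2 first.
- exact: msupp_uniq.
- by move=> x /msize_mdeg_lt /leq_trans /(_ fk) ->.
rewrite big_rmcond // => m /memN_msupp_eq0 ->; by rewrite !mul0r.
Qed.

Lemma fischer_is_linear g : linear_for *%R (fischer g).
Proof.
move=> c f h; pose k := maxn (msize (c *: f + h)) (maxn (msize f) (msize h)).
rewrite !(@fischerwE k) ?leq_max ?leqnn ?orbT //.
rewrite mulr_sumr -big_split; apply: eq_bigr => m _ /=.
by rewrite mcoeffD mcoeffZ !mulrDl !mulrA.
Qed.

HB.instance Definition _ g := GRing.isLinear.Build C {mpoly C[n]} C _
  (fischer g) (fischer_is_linear g).

Lemma fischerX g m : fischer g 'X_[m] = (g@_m)^* * (mfact m)%:R.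
Proof. by rewrite /fischer msuppX big_seq1 mcoeffX eqxx mul1r. Qed.

(** Multiplication by ['X_j] and the derivation along [j] are adjoint because raising the exponent
    [m j] by one multiplies the weight [mfact m] by [(m j).+1]. *)
Lemma fischer_mulX j g f : fischer g ('X_j * f) = fischer g^`M(j) f.
Proof.
rewrite [f]mpolyE mulr_sumr !linear_sum; apply: eq_bigr => m _ /=.
rewrite -scalerAr !linearZ /= -mpolyXD !fischerX addmC mcoeff_mderiv mfactDU.
by rewrite rmorphMn natrM mulrA -[(_)^* *+ _]mulr_natr.
Qed.

Lemma fischer_mderiv j g f : fischer g f^`M(j) = fischer ('X_j * g) f.
Proof.
rewrite [f]mpolyE (linear_sum (mderiv j)) (linear_sum (fischer g)) (linear_sum (fischer _)).
apply: eq_bigr => m _ /=.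
rewrite !linearZ /= mderivX linearZ /= !fischerX ['X_j * g]mulrC; congr (_ * _).
have [Um|nUm] := boolP (U_(j) <= m)%MM; last first.
  rewrite mcoeffMX_eq0 // conjC0 mul0r.
  by move: nUm; rewrite lep1mP negbK => /eqP ->; rewrite mul0r.
rewrite mcoeffMX_sub // -[in mfact m](submK Um) mfactDU mnmBE mnm1E eqxx natrM.
by move: Um; rewrite lep1mP -lt0n => mj; rewrite subn1 prednK // mulrCA.
Qed.

(** Positive definiteness: the summands are squared moduli of coefficients with positive weights. *)
Lemma fischer_eq0 f : fischer f f = 0 -> f = 0.
Proof.
have ge0 m : 0 <= f@_m * (f@_m)^* * (mfact m)%:R.
  by rewrite mulr_ge0 ?mul_conjC_ge0 ?ler0n.
move=> /eqP; rewrite /fischer psumr_eq0 // => /allP f0.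
apply/mpolyP => m; rewrite mcoeff0.
have [mf|/memN_msupp_eq0 //] := boolP (m \in msupp f).
have /= := f0 _ mf; rewrite !mulf_eq0 conjC_eq0 orbb pnatr_eq0.
by rewrite gtn_eqF ?mfact_gt0 // orbF => /eqP.
Qed.

Lemma fischer_disjoint g f : {in msupp f, forall m, g@_m = 0} -> fischer g f = 0.
Proof.
by move=> gf; rewrite /fischer big_seq big1 // => m /gf ->; rewrite conjC0 mulr0 mul0r.
Qed.

(* exp(laplacian / 2), truncated at order k: exact once k >= msize f. *)
Definition heat k f : {mpoly C[n]} :=
  \sum_(i < k) ((2 ^ i * i`!)%:R)^-1 *: iter i (@laplacian n C) f.

(** The conjugate of multiplication by ['X_j] under exp(laplacian / 2). *)
Definition heat_coord j f : {mpoly C[n]} := 'X_j * f + f^`M(j).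

Lemma heatS k f : (msize f <= k)%N -> heat k.+1 f = heat k f.
Proof. by move=> fk; rewrite /heat big_ord_recr /= iter_laplacian_eq0 // scaler0 addr0. Qed.

(** In the commutator formula the coefficient 2(i+1) / (2^(i+1) (i+1)!) equals 1 / (2^i i!), so the
    commutator terms reassemble into the derivative of the same series, shifted by one. The size
    hypothesis makes the term lost in the shift zero. *)
Lemma heat_mulX k j f : (msize f <= k)%N ->
  heat k.+1 ('X_j * f) = heat_coord j (heat k.+1 f).
Proof.
move=> fk; rewrite /heat_coord [X in _ + X^`M(_)](heatS fk) /heat linear_sum /=.
rewrite big_ord_recl [in RHS]big_ord_recl /= mulrDr -addrA; congr (_ + _).
  by rewrite -scalerAr.
rewrite mulr_sumr -big_split; apply: eq_bigr => i _ /=.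
rewrite /bump leq0n add1n -iterS iter_laplacian_mulX scalerDr scalerAr mderivZ.
congr (_ + _); rewrite -scaler_nat scalerA; congr (_ *: _).
rewrite expnS factS !natrM.
rewrite add0n; have nz l : (0 < l)%N -> (l%:R : C) != 0 by rewrite pnatr_eq0 lt0n.
have := nz _ (ltn0Sn i); have := nz _ (fact_gt0 i); have : ((2 ^ i)%:R : C) != 0.
  by apply: nz; rewrite expn_gt0.
move: (_%:R : C) (_%:R : C) (i.+1%:R : C) => a b c a0 b0 c0.
by field; rewrite a0 b0 c0.
Qed.

Lemma mcoeff_heat_eq0 k f m : (msize f <= mdeg m)%N -> (heat k f)@_m = 0.
Proof.
move=> fm; rewrite /heat raddf_sum big1 // => i _ /=.
by rewrite mcoeffZ mcoeff_iter_laplacian_eq0 ?mulr0 //; apply: leq_trans fm (leq_addr _ _).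
Qed.

(** All terms of the series but the first have smaller degree, so the leading coefficient of [f]
    survives. *)
Lemma heat_eq0 k f : heat k.+1 f = 0 -> f = 0.
Proof.
move=> f0; apply/eqP; apply: contraT => fN0; move: (fN0).
rewrite -mleadc_eq0 => /negP[]; apply/eqP.
have := congr1 (mcoeff (mlead f)) f0.
rewrite mcoeff0 /heat big_ord_recl /= raddfD raddf_sum /= mcoeffZ big1 ?addr0.
  by rewrite mul1n fact0 invr1 mul1r.
move=> i _; rewrite /bump leq0n add1n -iterS mcoeffZ mcoeff_iter_laplacian_eq0 ?mulr0 //.
by rewrite -mlead_deg // addnS ltnS leq_addr.
Qed.

(** The operator is self-adjoint, its two summands being adjoint to each other. *)
Lemma fischer_heat_coord j g f :
  fischer g (heat_coord j f) = fischer (heat_coord j g) f.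
Proof.
rewrite /heat_coord linearD /= fischer_mulX fischer_mderiv -addrC.
rewrite /fischer -big_split; apply: eq_bigr => m _ /=.
by rewrite mcoeffD rmorphD mulrDr mulrDl.
Qed.

Lemma heat_coordC i j f : heat_coord i (heat_coord j f) = heat_coord j (heat_coord i f).
Proof.
rewrite /heat_coord !mderivD !mderivM !mderivX !mnm1E eq_sym (mderiv_comm i j).
by case: eqP => [->|_]; rewrite ?scale0r; ring.
Qed.

Lemma msize_mulX j f : (msize ('X_j * f)%R <= (msize f).+1)%N.
Proof.
rewrite mulrC msizeE big_seq; apply/bigmax_leqP_seq => /= m mf _.
move: mf; rewrite (perm_mem (msuppMX f _)) => /mapP[l lf ->].
by rewrite mdegD mdeg1 add1n ltnS msize_mdeg_lt.
Qed.

Lemma heat_biharmonic k f : laplacian (laplacian f) = 0 ->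
  heat k.+2 f = f + (2%:R)^-1 *: laplacian f.
Proof.
move=> LLf; rewrite /heat 2!big_ord_recl big1 => [|l _].
  by rewrite addr0 !mul1n fact0 invr1 scale1r.
have it0 l' : iter l'.+2 (@laplacian n C) f = 0.
  by elim: l' => [|l' IH]; [exact: LLf | rewrite iterS IH raddf0].
have -> : iter (lift ord0 (lift ord0 l)) (@laplacian n C) f = 0 by exact: it0.
by rewrite scaler0.
Qed.

(* With T = exp(laplacian / 2) and [a_i = heat_coord i], the degree hypotheses give
   0 = <T V, T (x_i^2 x_j^2 V)> = <T V, a_i^2 a_j^2 T V> = |T (x_i x_j V)|^2. *)
Lemma biharmonic_dvd_eq0 (i j : 'I_n) (V : {mpoly C[n]}) d :
  let U := 'X_i * ('X_i * ('X_j * ('X_j * V))) in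
  (msize V <= d)%N ->
  {in msupp U, forall m, d <= mdeg m}%N ->
  {in msupp (laplacian U), forall m, d <= mdeg m}%N ->
  laplacian (laplacian U) = 0 -> V = 0.
Proof.
move=> U Vd Ud LUd LLU.
(* Large enough for [heat_mulX] at each of the four multiplications by a coordinate. *)
pose k := (msize V + 4)%N.
have sz1 (W : {mpoly C[n]}) l : (msize W <= l)%N -> (msize ('X_j * W) <= l.+1)%N.
  by move=> Wl; apply: leq_trans (msize_mulX _ _) _.
have sz2 (W : {mpoly C[n]}) l : (msize W <= l)%N -> (msize ('X_i * W) <= l.+1)%N.
  by move=> Wl; apply: leq_trans (msize_mulX _ _) _.
have k0 : (msize V <= msize V)%N by [].
have k1 := sz1 _ _ k0; have k2 := sz1 _ _ k1; have k3 := sz2 _ _ k2; have k1' := sz2 _ _ k1.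
have TU : heat k.+1 U = U + (2%:R)^-1 *: laplacian U.
  by rewrite /k addn4 heat_biharmonic.
(* The supports are disjoint: [heat k.+1 V] has only monomials of degree below [d], while [U] and
   [laplacian U] have none of these. *)
have : fischer (heat k.+1 V) (heat k.+1 U) = 0.
  have V0 m : (d <= mdeg m)%N -> (heat k.+1 V)@_m = 0.
    by move=> dm; apply: mcoeff_heat_eq0; apply: leq_trans Vd dm.
  rewrite TU linearD linearZ /= !fischer_disjoint ?mulr0 ?addr0 //.
    by move=> m /LUd /V0.
  by move=> m /Ud /V0.
have -> : heat k.+1 U = heat_coord i (heat_coord i (heat_coord j (heat_coord j (heat k.+1 V)))).
  by rewrite /U !heat_mulX // /k; lia.
rewrite fischer_heat_coord (heat_coordC i j) fischer_heat_coord (heat_coordC j i).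
have <- : heat k.+1 ('X_i * ('X_j * V)) = heat_coord i (heat_coord j (heat k.+1 V)).
  by rewrite !heat_mulX // /k; lia.
move=> /fischer_eq0/heat_eq0/eqP.
have X0 l : ('X_l : {mpoly C[n]}) != 0 by rewrite -msize_poly_eq0 msizeX.
by rewrite !mulf_eq0 !(negbTE (X0 _)) /= => /eqP.
Qed.

End Fischer.

(** * Polynomials vanishing on the isotropic cone *)

Lemma poly_infinite_roots_eq0 (C : idomainType) (p : {poly C}) (s : nat -> C) :
  injective s -> (forall k, root p (s k)) -> p = 0.
Proof.
move=> s_inj ps; apply/eqP; apply: contraT => p0.
have := max_poly_roots p0 _ (_ : uniq (mkseq s (size p))).
rewrite size_mkseq ltnn => -> //; last by rewrite mkseq_uniq.
by apply/allP => _ /mapP[k _ ->].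
Qed.

Section Vanishing.
Variables (n : nat) (C : numDomainType).
Implicit Types (f : {mpoly C[n]}) (v : 'I_n -> C).

(* Rescaling the coordinate [j] by [t] and reading off the coefficient of t^(m0 j)
   isolates the monomials with the same j-exponent as [m0]. *)
Lemma meval_eq0_slice f (m0 : 'X_{1..n}) (s : seq 'I_n) :
  (forall v, f.@[v] = 0) -> forall v,
  \sum_(m <- msupp f | all (fun j => m j == m0 j) s) f@_m * \prod_i v i ^+ m i = 0.
Proof.
move=> f0; elim: s => [|j s IH] v; first by rewrite -mevalE f0.
pose p := \sum_(m <- msupp f | all (fun j => m j == m0 j) s)
  (f@_m * \prod_i v i ^+ m i) *: 'X^(m j).
have p0 : p = 0.
  apply: (@poly_infinite_roots_eq0 _ _ (fun k => k%:R)).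
    by move=> a b /eqP; rewrite eqr_nat => /eqP.
  move=> t; apply/rootP; rewrite horner_sum -[RHS](IH (fun i => v i * (if i == j then t%:R else 1))).
  apply: eq_bigr => m _; rewrite hornerZ hornerXn -mulrA; congr (_ * _).
  under [in RHS]eq_bigr do rewrite exprMn.
  rewrite big_split /=; congr (_ * _).
  rewrite (bigD1 j) //= eqxx big1 ?mulr1 // => i /negbTE ->.
  by rewrite expr1n.
have := congr1 (fun q : {poly C} => q`_(m0 j)) p0; rewrite coef0 coef_sum => p0m.
rewrite -[RHS]p0m [LHS]big_mkcond [RHS]big_mkcond; apply: eq_bigr => m _ /=.
rewrite coefZ coefXn eq_sym.
by case: eqP; case: all; rewrite ?mulr1 ?mulr0.
Qed.

Lemma meval_eq0 f : (forall v, f.@[v] = 0) -> f = 0.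
Proof.
move=> f0; apply/mpolyP => m0; rewrite mcoeff0.
have [m0f|/memN_msupp_eq0 //] := boolP (m0 \in msupp f).
have := meval_eq0_slice m0 (enum 'I_n) f0 (fun=> 1).
rewrite (eq_bigl (fun m => m == m0)); last first.
  move=> m; apply/allP/eqP => [mm0|->//]; apply/mnmP => i.
  by apply/eqP/mm0; rewrite mem_enum.
rewrite -big_filter filter_pred1_uniq ?msupp_uniq // big_seq1.
by rewrite big1 ?mulr1 // => i _; rewrite expr1n.
Qed.

End Vanishing.

Section Quadric.
Variables (n : nat) (C : numClosedFieldType).
Implicit Types (f A B T : {mpoly C[n]}) (v w : 'I_n -> C).

Definition quadric : {mpoly C[n]} := \sum_(j < n) 'X_j ^+ 2.

Lemma meval_quadric v : quadric.@[v] = \sum_(j < n) v j ^+ 2.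
Proof. by rewrite raddf_sum; apply: eq_bigr => j _ /=; rewrite expr2 mevalM mevalXU. Qed.

(** Independence of ['X_j] is stated through values, which makes it stable under ring operations
    without any work on coefficients. *)
Definition free_of (j : 'I_n) f :=
  forall v w, (forall i, i != j -> v i = w i) -> f.@[v] = f.@[w].

Let s (j : 'I_n) : {mpoly C[n]} := \sum_(i < n | i != j) 'X_i ^+ 2.

Let meval_s j v : (s j).@[v] = \sum_(i < n | i != j) v i ^+ 2.
Proof. by rewrite raddf_sum; apply: eq_bigr => i _ /=; rewrite expr2 mevalM mevalXU. Qed.

Let free_s j : free_of j (s j).
Proof. by move=> v w vw; rewrite !meval_s; apply: eq_bigr => i /vw ->. Qed.

(** [quadric] is monic of degree 2 in ['X_j]. The polynomials that admit such a division are closed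
    under sums, scalars and multiplication by variables, and contain 1. *)
Lemma quadric_division (j : 'I_n) f : exists T A B,
  [/\ free_of j A, free_of j B & f = quadric * T + A * 'X_j + B].
Proof.
pose D g := exists T A B,
  [/\ free_of j A, free_of j B & g = quadric * T + A * 'X_j + B].
have D0 : D 0.
  by exists 0, 0, 0; split; rewrite ?mulr0 ?mul0r ?addr0 // => v w _; rewrite !meval0.
have DD g h : D g -> D h -> D (g + h).
  move=> [T1 [A1 [B1 [fA1 fB1 ->]]]] [T2 [A2 [B2 [fA2 fB2 ->]]]].
  exists (T1 + T2), (A1 + A2), (B1 + B2); split; last by ring.
  - by move=> v w vw; rewrite !mevalD (fA1 _ _ vw) (fA2 _ _ vw).
  - by move=> v w vw; rewrite !mevalD (fB1 _ _ vw) (fB2 _ _ vw).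
have DZ c g : D g -> D (c *: g).
  move=> [T [A [B [fA fB ->]]]]; exists (c *: T), (c *: A), (c *: B); split.
  - by move=> v w vw; rewrite !mevalZ (fA _ _ vw).
  - by move=> v w vw; rewrite !mevalZ (fB _ _ vw).
  - by rewrite !scalerDr scalerAr -scalerAl.
have DX i g : D g -> D ('X_i * g).
  move=> [T [A [B [fA fB ->]]]]; case: (eqVneq i j) => [->|ij].
    (* In ['X_j * (A * 'X_j + B)] the square of ['X_j] is replaced by [quadric - s j]. *)
    exists ('X_j * T + A), B, (- (A * s j)); split=> //.
      by move=> v w vw; rewrite !mevalN !mevalM (fA _ _ vw) (free_s vw).
    have -> : quadric = 'X_j ^+ 2 + s j by rewrite /quadric (bigD1 j).
    by ring.
  exists ('X_i * T), ('X_i * A), ('X_i * B); split; last by ring.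
  - by move=> v w vw; rewrite !mevalM !mevalXU (fA _ _ vw) vw.
  - by move=> v w vw; rewrite !mevalM !mevalXU (fB _ _ vw) vw.
have D1 : D 1.
  by exists 0, 0, 1; split; rewrite ?mulr0 ?mul0r ?add0r // => v w _; rewrite !(meval0, meval1).
rewrite -/(D f) [f]mpolyE; apply: big_ind => // m _; apply: DZ.
rewrite mpolyXE_id; elim/big_rec: _ => // i g _ Dg.
by elim: (m i) => [|k IH]; rewrite ?expr0 ?mul1r // exprS -mulrA; exact: DX.
Qed.

(* At both points over [v] the remainder A X_j + B takes the value 0, hence B = 0
   and A (X_j^2 - quadric) = 0. *)
Lemma quadric_dvd f : (1 < n)%N ->
  (forall v, quadric.@[v] = 0 -> f.@[v] = 0) -> exists T, f = quadric * T.
Proof.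
move=> n1 f0; pose j0 := Ordinal (ltnW n1); pose j1 := Ordinal n1.
have [T [A [B [fA fB fE]]]] := quadric_division j0 f; exists T.
pose u v r i := if i == j0 then r : C else v i.
have uE v r i : i != j0 -> u v r i = v i by rewrite /u => /negbTE ->.
have AB v r : r ^+ 2 = - (s j0).@[v] -> A.@[v] * r + B.@[v] = 0.
  move=> rs.
  have qu : quadric.@[u v r] = 0.
    rewrite meval_quadric (bigD1 j0) //= {1}/u eqxx rs meval_s.
    rewrite [X in _ + X](eq_bigr (fun i => v i ^+ 2)) ?addNr // => i ij.
    by rewrite uE.
  have := f0 _ qu; rewrite fE !mevalD !mevalM mevalXU qu mul0r add0r {2}/u eqxx.
  by rewrite (fA _ v) ?(fB _ v) // => i; exact: uE.
have AB2 v : B.@[v] = 0 /\ A.@[v] * sqrtC (- (s j0).@[v]) = 0.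
  have h1 := AB v _ (sqrtCK _).
  have h2 : A.@[v] * - sqrtC (- (s j0).@[v]) + B.@[v] = 0.
    by apply: AB; rewrite sqrrN sqrtCK.
  have B0 : B.@[v] *+ 2 = 0.
    by rewrite -[RHS](addr0 0) -{1}h1 -{1}h2; ring.
  have {}B0 : B.@[v] = 0 by move/eqP: B0; rewrite mulrn_eq0 /= => /eqP.
  by split=> //; rewrite B0 addr0 in h1.
have B0 : B = 0 by apply: meval_eq0 => v; case: (AB2 v).
have A0 : A * s j0 = 0.
  apply: meval_eq0 => v; have [_ A0] := AB2 v.
  by rewrite mevalM -[(s j0).@[v]]opprK -[- _.@[v]]sqrtCK mulrN expr2 mulrA A0 mul0r oppr0.
(* A second variable is needed here: [s j0] takes the value 1 at the basis vector of index [j1]. *)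
have s0 : s j0 != 0.
  apply/eqP => /(congr1 (meval (fun i => (i == j1)%:R))); rewrite meval0 meval_s.
  rewrite (bigD1 j1) //= ?eqxx big1 ?expr1n ?addr0; first by move/eqP; rewrite oner_eq0.
  by move=> i /andP[_ /negbTE ->]; rewrite expr0n.
by move/eqP: A0; rewrite mulf_eq0 (negbTE s0) orbF => /eqP A0; rewrite fE A0 B0 mul0r !addr0.
Qed.

Lemma mcoeff_quadricM T m : (quadric * T)@_m =
  \sum_(k < n) (if (U_(k) *+ 2 <= m)%MM then T@_(m - U_(k) *+ 2) else 0).
Proof.
rewrite /quadric mulr_suml raddf_sum; apply: eq_bigr => k _ /=.
by rewrite mpolyXn mulrC; case: ifPn => km; [rewrite mcoeffMX_sub|rewrite mcoeffMX_eq0].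
Qed.

(** As [quadric] is monic in ['X_j], the product with [T] has degree in ['X_j] exactly two more than
    [T]. *)
Lemma degree_quadricM T (j : 'I_n) M :
  {in msupp (quadric * T), forall m : 'X_{1..n}, m j <= M}%N ->
  {in msupp T, forall m : 'X_{1..n}, m j + 2 <= M}%N.
Proof.
move=> qTM; suff H k m : m \in msupp T -> (msize T <= m j + k)%N -> (m j + 2 <= M)%N.
  by move=> m mT; apply: (H (msize T) m mT); rewrite leq_addl.
elim: k m => [|k IH] m mT Tm.
  have := msize_mdeg_lt mT; rewrite mdegE (bigD1 j) //=; lia.
pose m2 := (m + U_(j) *+ 2)%MM.
have m2E i : m2 i = (m i + 2 * (i == j))%N.
  by rewrite mnmDE mulmnE mnm1E eq_sym mulnC.
have [/qTM|] := boolP (m2 \in msupp (quadric * T)); first by rewrite m2E eqxx muln1.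
move/memN_msupp_eq0; rewrite mcoeff_quadricM (bigD1 j) //= lem_addl addmK => Tm0.
(* If the coefficient of the product at [m2] vanishes, [T@_m] is cancelled by a monomial
   [m2 - 2 U_(i)] of [T] with [i != j], whose exponent at [j] is [m j + 2]. *)
have [/existsP[i /and3P[ij im2 mi]]|] := boolP [exists i : 'I_n,
    [&& i != j, (U_(i) *+ 2 <= m2)%MM & (m2 - U_(i) *+ 2)%MM \in msupp T]].
  have m2j : (m2 - U_(i) *+ 2)%MM j = (m j + 2)%N.
    by rewrite mnmBE m2E eqxx mulmnE mnm1E (negbTE ij) subn0.
  by have := IH _ mi; rewrite m2j; lia.
rewrite negb_exists => /forallP no.
move: Tm0; rewrite big1 ?addr0 => [Tm0|i ij].
  by move: mT; rewrite mcoeff_msupp Tm0 eqxx.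
have := no i; rewrite ij /=; case: ifP => //= _ /memN_msupp_eq0 //.
Qed.

End Quadric.

(** * The reciprocal transform *)

Section Borel.
Variables (n M : nat) (C : numClosedFieldType).
Implicit Types (f P T U : {mpoly C[n]}) (m : 'X_{1..n}).

Definition mconst : 'X_{1..n} := [multinom M | _ < n].

(* The polynomial (X_1 ... X_n)^(M+1) times the Laplace transform of P. *)
Definition reciprocal P : {mpoly C[n]} :=
  \sum_(m <- msupp P) (P@_m * (mfact m)%:R) *: 'X_[mconst - m].

(** Dividing ['X_[m]] by (X_1 ... X_n)^(M+1) leaves the inverse of a monomial with exponents M - m_j
    + 1, the transform of x^(M-m) / (M-m)!. If some exponent exceeds [M] the value is 0, in
    agreement with the derivative of a constant. *)
Definition antireciprocalX m : {mpoly C[n]} :=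
  if (m <= mconst)%MM
  then ((mfact (mconst - m))%:R)^-1 *: 'X_[mconst - m] else 0.

(* Inverse Laplace transform of f / (X_1 ... X_n)^(M+1); it turns multiplication by X_j into
   differentiation, and [reciprocal] is inverted by it. *)
Definition antireciprocal f : {mpoly C[n]} :=
  \sum_(m : 'X_{1..n < (mdeg mconst).+1}) f@_m *: antireciprocalX m.

Lemma antireciprocal_is_linear : linear antireciprocal.
Proof.
move=> c f g; rewrite /antireciprocal scaler_sumr -big_split; apply: eq_bigr => m _ /=.
by rewrite mcoeffD mcoeffZ scalerDl scalerA.
Qed.

HB.instance Definition _ := GRing.isLinear.Build C {mpoly C[n]} {mpoly C[n]} _
  antireciprocal antireciprocal_is_linear.

Lemma antireciprocal_mpolyX m : antireciprocal 'X_[m] = antireciprocalX m.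
Proof.
rewrite /antireciprocal; have [mM|Mm] := ltnP (mdeg m) (mdeg mconst).+1.
  rewrite (bigD1 (BMultinom mM)) //= mcoeffX eqxx scale1r big1 ?addr0 // => l lm.
  rewrite mcoeffX [_ == _](_ : _ = false) ?scale0r //.
  by apply/negbTE; move: lm; rewrite -val_eqE eq_sym.
rewrite /antireciprocalX; case: ifP => [mM|_].
  have := mdegD (mconst - m) m; rewrite submK //; lia.
rewrite big1 // => l _; rewrite mcoeffX; case: eqP => [ml|_]; last by rewrite scale0r.
by move: (bmdeg l); rewrite -ml; lia.
Qed.

Lemma antireciprocal_mulX j f : antireciprocal ('X_j * f) = (antireciprocal f)^`M(j).
Proof.
rewrite [f]mpolyE mulr_sumr (linear_sum antireciprocal) (linear_sum antireciprocal).
rewrite (linear_sum (mderiv j)); apply: eq_bigr => m _ /=.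
rewrite -scalerAr !linearZ /= -mpolyXD !antireciprocal_mpolyX; congr (_ *: _).
rewrite /antireciprocalX addmC.
have [mM|mM] := boolP (m <= mconst)%MM; last first.
  rewrite raddf0; case: ifP => // mU.
  by case/negP: mM; apply: lepm_trans mU; exact: lem_addr.
rewrite linearZ /= mderivX scalerA mnmBE mnmE.
have subU : (mconst - (m + U_(j)) = mconst - m - U_(j))%MM by rewrite submDA.
case: ifP => mUM.
  rewrite subU; congr (_ *: _).
  have le : (U_(j) <= mconst - m)%MM.
    rewrite lep1mP mnmBE mnmE; move/mnm_lepP/(_ j): mUM.
    by rewrite mnmDE mnm1E eqxx mnmE; lia.
  have mj : ((mconst - m)%MM j = M - m j)%N by rewrite mnmBE mnmE.
  rewrite -[in (mconst - m)%MM](submK le) mfactDU mnmBE mj mnm1E eqxx natrM.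
  move: le; rewrite lep1mP mj => le.
  have -> : (M - m j - 1).+1 = (M - m j)%N by lia.
  have nz : (M - m j)%:R != 0 :> C by rewrite pnatr_eq0.
  have nz2 : (mfact (mconst - m - U_(j))%MM)%:R != 0 :> C.
    by rewrite pnatr_eq0 -lt0n mfact_gt0.
  by rewrite addmK invfM mulrAC mulVf // mul1r.
(* Here [m j] has already reached [M]: the image of ['X_[m]] does not involve ['X_j], and its
   derivative is 0. *)
have -> : (M - m j = 0)%N; last by rewrite mulr0 scale0r.
apply/eqP; rewrite subn_eq0 leqNgt; apply/negP => mj.
move/negP: mUM; apply; apply/mnm_lepP => i; rewrite mnmDE mnm1E.
move/mnm_lepP/(_ i): mM; rewrite !mnmE; case: eqP => [<-|] /=; lia.
Qed.

Lemma antireciprocal_quadric T :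
  antireciprocal (quadric n C * T) = laplacian (antireciprocal T).
Proof.
rewrite /quadric mulr_suml (linear_sum antireciprocal) /=.
by apply: eq_bigr => j _ /=; rewrite expr2 -mulrA !antireciprocal_mulX.
Qed.

Lemma antireciprocalK P : {in msupp P, forall m, m <= mconst}%MM ->
  antireciprocal (reciprocal P) = P.
Proof.
move=> PM; rewrite /reciprocal (linear_sum antireciprocal) /= [RHS]mpolyE.
apply: eq_big_seq => m /PM mM.
rewrite linearZ /= antireciprocal_mpolyX /antireciprocalX lem_subr.
have -> : (mconst - (mconst - m) = m)%MM.
  by apply/mnmP => i; move/mnm_lepP/(_ i): mM; rewrite !mnmBE mnmE; lia.
rewrite scalerA -mulrA divff ?mulr1 //.
by rewrite pnatr_eq0 -lt0n mfact_gt0.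
Qed.

Lemma antireciprocal_degree T (j : 'I_n) d : {in msupp T, forall m : 'X_{1..n}, m j + d <= M}%N ->
  {in msupp (antireciprocal T), forall m : 'X_{1..n}, d <= m j}%N.
Proof.
move=> TM m; rewrite mcoeff_msupp => mU; rewrite leqNgt; apply/negP => md.
move/eqP: mU; apply; rewrite /antireciprocal raddf_sum big1 //= => l _.
rewrite mcoeffZ; have [/TM lT|/memN_msupp_eq0 ->] := boolP (val l \in msupp T); last by rewrite mul0r.
rewrite /antireciprocalX; case: ifP => _; last by rewrite mcoeff0 mulr0.
rewrite mcoeffZ mcoeffX; case: eqP => [lm|_]; last by rewrite !mulr0.
by move: md lT; rewrite -lm mnmBE mnmE /=; lia.
Qed.

Lemma msupp_reciprocal P j : {in msupp (reciprocal P), forall m : 'X_{1..n}, m j <= M}%N.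
Proof.
move=> m /msupp_sum_le/flatten_mapP[l _].
by move/msuppZ_le/mem_msuppXP => <-; rewrite mnmBE mnmE leq_subr.
Qed.

Lemma meval_reciprocal P (v : 'I_n -> C) : (forall j, v j != 0) ->
  {in msupp P, forall m, m <= mconst}%MM ->
  (reciprocal P).@[v] = (\prod_j v j ^+ M.+1) *
    \sum_(m <- msupp P) P@_m * (mfact m)%:R * \prod_j (v j)^-1 ^+ (m j).+1.
Proof.
move=> v0 PM; rewrite /reciprocal raddf_sum mulr_sumr; apply: eq_big_seq => m /PM mM /=.
rewrite mevalZ mevalX mulrCA; congr (_ * _); rewrite -big_split; apply: eq_bigr => j _ /=.
move/mnm_lepP/(_ j): mM; rewrite mnmBE mnmE => mM.
have -> : (M - m j = M.+1 - (m j).+1)%N by [].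
by rewrite exprVn expfB_cond // (negbTE (v0 j)) add0n ltnS.
Qed.

(** With exponents strictly below [M], each monomial of [reciprocal P] contains ['X_j]. This covers
    the points with a zero coordinate, about which [vanishes_on] says nothing. *)
Lemma meval_reciprocal_eq0 P (v : 'I_n -> C) j : v j = 0 ->
  {in msupp P, forall m : 'X_{1..n}, m j < M}%N -> (reciprocal P).@[v] = 0.
Proof.
move=> vj PM; rewrite /reciprocal raddf_sum big_seq big1 //= => m /PM mM.
rewrite mevalZ mevalX (bigD1 j) //= vj mnmBE mnmE expr0n subn_eq0 leqNgt mM.
by rewrite mul0r mulr0.
Qed.

End Borel.

(** * Harmonic polynomials whose reciprocal is divisible by the quadric *)

Section HarmonicReciprocal.
Variables (n : nat) (C : numClosedFieldType).
Implicit Types (P T U : {mpoly C[n]}) (m : 'X_{1..n}).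

Lemma mcoeff_pihomog d U m :
  (pihomog (@mdeg n) d U)@_m = if mdeg m == d then U@_m else 0.
Proof.
have [md|md] := eqVneq (mdeg m) d; last first.
  by apply: dhomog_nemf_coeff md; exact: pihomogP.
rewrite pihomogE raddf_sum big_mkcond /= [in RHS](mpolyE U) raddf_sum; apply: eq_bigr => l _ /=.
case: eqP => // ld; rewrite mcoeffZ mcoeffX; case: eqP => [lm|]; last by rewrite mulr0.
by rewrite lm in ld.
Qed.

Lemma laplacian_pihomog d U :
  laplacian (pihomog (@mdeg n) d.+2 U) = pihomog (@mdeg n) d (laplacian U).
Proof.
apply/mpolyP => m; rewrite mcoeff_pihomog !mcoeff_laplacian.
have [md|md] := eqVneq (mdeg m) d.
  by apply: eq_bigr => j _; rewrite mcoeff_pihomog !mdegD mdeg1 !addn1 md eqxx.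
apply: big1 => j _; rewrite mcoeff_pihomog !mdegD mdeg1 !addn1 !eqSS (negbTE md).
by rewrite mul0rn.
Qed.

Lemma harmonic_reciprocal_eq0 N M T P : (1 < n)%N -> P \is N.-homog ->
  {in msupp P, forall m, m <= mconst n M}%MM ->
  laplacian P = 0 -> reciprocal M P = quadric n C * T -> P = 0.
Proof.
move=> n1 PN PM LP PT; pose j0 := Ordinal (ltnW n1); pose j1 := Ordinal n1.
(* [T] is not assumed homogeneous; the component of degree [N.+2] suffices, since the Laplacian
   sends it to the component of degree [N] of [P], that is [P]. *)
pose U := pihomog (@mdeg n) N.+2 (antireciprocal M T).
have LU : laplacian U = P.
  rewrite laplacian_pihomog -antireciprocal_quadric -PT antireciprocalK //.
  exact: pihomog_dE.
(* Exponents are at most [M] in [reciprocal P], hence at most [M - 2] in [T], and [antireciprocal]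
   turns this into at least 2. *)
have Usupp m j : m \in msupp U -> (mdeg m = N.+2 /\ 2 <= m j)%N.
  rewrite mcoeff_msupp mcoeff_pihomog; case: (mdeg m =P _) => [md|_]; last by rewrite eqxx.
  rewrite -mcoeff_msupp => mT; split=> //; move: m mT {md}.
  apply: antireciprocal_degree; apply: degree_quadricM.
  by rewrite -PT; exact: msupp_reciprocal.
pose k : 'X_{1..n} := (U_(j0) + (U_(j0) + (U_(j1) + U_(j1))))%MM.
pose V := \sum_(m <- msupp U) U@_m *: 'X_[m - k].
have kU m : m \in msupp U -> (k <= m)%MM.
  move=> mU; apply/mnm_lepP => i; rewrite !mnmDE !mnm1E.
  have [_ h0] := Usupp m j0 mU; have [_ h1] := Usupp m j1 mU.
  have [<-|_] := eqVneq j0 i; first by rewrite /=; lia.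
  by have [<-|_] := eqVneq j1 i; rewrite /=; lia.
have UE : U = 'X_j0 * ('X_j0 * ('X_j1 * ('X_j1 * V))).
  rewrite !mulrA -!mpolyXD -!addmA -/k /V mulr_sumr [LHS]mpolyE.
  by apply: eq_big_seq => m /kU km; rewrite -scalerAr -mpolyXD addmC submK.
have V0 : V = 0.
  (* The threshold [N] separates the degree [N - 2] of [V] from the degrees [N + 2] of [U] and [N]
     of its Laplacian. *)
  apply: (@biharmonic_dvd_eq0 _ _ j0 j1 V N); rewrite -?UE.
  - rewrite msizeE; apply/bigmax_leqP_seq => m + _.
    move=> /msupp_sum_le/flatten_mapP[l]; rewrite filter_predT => lU.
    move=> /msuppZ_le/mem_msuppXP lm.
    have := mdegD (l - k) k; rewrite submK ?kU // lm (Usupp l j0 lU).1.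
    by rewrite !mdegD !mdeg1; lia.
  - by move=> m /(Usupp m j0)[-> _]; lia.
  - by rewrite LU; move=> m /(dhomogP _ _ _ PN) ->.
  - by rewrite LU.
by rewrite -LU UE V0 !mulr0 raddf0.
Qed.

End HarmonicReciprocal.

(** * Rational curves in the cone *)

Lemma horner_mmap (C : comNzRingType) n (c : 'I_n -> {poly C}) (f : {mpoly C[n]}) t :
  (mmap polyC c f).[t] = f.@[fun j => (c j).[t]].
Proof.
rewrite /mmap horner_sum mevalE; apply: eq_bigr => m _.
rewrite hornerM hornerC horner_prod; congr (_ * _).
by apply: eq_bigr => j _; rewrite horner_exp.
Qed.

Lemma continuous_horner_num (K : numFieldType) (p : {poly K}) :
  continuous (horner p : K^o -> K^o).
Proof.
elim/poly_ind: p => [|p a IH] t.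
  rewrite (_ : horner 0 = cst 0); first exact: cst_continuous.
  by apply/funext => u; rewrite horner0.
rewrite (_ : horner _ = (fun u => p.[u] * u + a)); last first.
  by apply/funext => u; rewrite hornerMXaddC.
have hM : (fun u : K^o => p.[u] * u : K^o) @ t --> (p.[t] * t : K^o).
  by apply: (@cvgM K K^o (nbhs t) _ (fun u => p.[u]) (fun u => u)); [exact: IH|exact: (@cvg_id K^o)].
exact: (@cvgD K K^o _ _ _ _ _ _ _ hM (cvg_cst _)).
Qed.

Lemma curve_near (K : numFieldType) n (c : 'I_n -> {poly K}) (U : set 'rV[K^o]_n) :
  open U -> U (\row_j (c j).[0]) ->
  exists2 e : K, 0 < e & forall t, `|t| < e -> U (\row_j (c j).[t]).
Proof.
move=> oU U0.
have /nbhs_ballP[e /= e0 eU] : nbhs (\row_j (c j).[0] : 'rV[K^o]_n) U by exact: open_nbhs_nbhs.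
have : \forall t \near (0 : K^o), forall j, ball ((c j).[0] : K^o) e ((c j).[t] : K^o).
  apply: (@filter_forall _ _ (fun j t => ball ((c j).[0] : K^o) e ((c j).[t] : K^o)) (nbhs (0 : K^o))) => j.
  exact: (@continuous_horner_num K (c j) 0 _ (nbhsx_ballx ((c j).[0] : K^o) e e0)).
move=> /nbhs_ballP[d /= d0 dU]; exists d => // t td; apply: eU; split=> // i j.
rewrite !mxE; apply: dU; by rewrite -ball_normE /= sub0r normrN.
Qed.

(** Along a polynomial curve [f] becomes a polynomial in [t]; since [W] is relatively open, it has
    infinitely many zeros near 0. *)
Lemma vanish_on_curve (R : realType) n (f : {mpoly R[i][n]}) (V W : set 'rV[R[i]]_n)
    (c : 'I_n -> {poly R[i]}) :
  relatively_open V W -> W (\row_j (c j).[0]) -> (forall t, V (\row_j (c j).[t])) ->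
  (forall rho, W rho -> f.@[fun j => rho 0 j] = 0) ->
  forall t, f.@[fun j => (c j).[t]] = 0.
Proof.
move=> [U oU ->] [U0 V0] cV f0.
have [e e0 eU] := curve_near oU U0.
suff g0 : mmap polyC c f = 0 by move=> t; rewrite -horner_mmap g0 horner0.
(* The shift by two keeps all these parameters strictly below [e]. *)
apply: (@poly_infinite_roots_eq0 _ _ (fun k => e / k.+2%:R)).
  move=> a b /(mulfI (lt0r_neq0 e0)) /invr_inj /eqP.
  by rewrite eqr_nat => /eqP [].
move=> k; apply/rootP; rewrite horner_mmap.
rewrite -(f0 (\row_j (c j).[e / k.+2%:R])); first by apply: meval_eq => j; rewrite mxE.
split=> //; apply: eU.
by rewrite ger0_norm ?divr_ge0 ?ler0n ?ltW // ltr_pdivrMr ?ltr0n // ltr_pMr // ltr1n.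
Qed.

(** The three equations say exactly what is needed for the conic (1-t)^2 p + t(1-t) y + t^2 q to be
    isotropic for all t. *)
Lemma isotropic_joining (C : numClosedFieldType) n (p q : 'I_n -> C) : (2 < n)%N ->
  \sum_j p j ^+ 2 = 0 -> \sum_j q j ^+ 2 = 0 ->
  exists y, [/\ \sum_j y j * p j = 0, \sum_j y j * q j = 0 &
    \sum_j y j ^+ 2 = - (\sum_j p j * q j) *+ 2].
Proof.
move=> n2 pp qq; set c := \sum_j p j * q j.
have [c0|c0] := eqVneq c 0.
  exists (fun=> 0); split; rewrite ?big1 ?c0 ?oppr0 ?mul0rn // => j _; rewrite ?mul0r //.
  by rewrite expr0n.
(* The projection of the [k]-th basis vector to the orthogonal complement of [p] and [q], which
   exists as [c] is nonzero. *)
pose z k j := (j == k)%:R - q k / c * p j - p k / c * q j.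
have delta (F : 'I_n -> C) k : \sum_j (j == k)%:R * F j = F k.
  by rewrite (bigD1 k) //= eqxx mul1r big1 ?addr0 // => j /negbTE ->; rewrite mul0r.
have zz k (F : 'I_n -> C) : \sum_j z k j * F j =
    F k - q k / c * (\sum_j p j * F j) - p k / c * (\sum_j q j * F j).
  rewrite -(delta F k) !mulr_sumr -!sumrB; apply: eq_bigr => j _.
  by rewrite /z !mulrBl !mulrA.
have pp' : \sum_j p j * p j = 0 by rewrite -[RHS]pp; apply: eq_bigr.
have qq' : \sum_j q j * q j = 0 by rewrite -[RHS]qq; apply: eq_bigr.
have qp : \sum_j q j * p j = c by apply: eq_bigr => j _; rewrite mulrC.
have zp k : \sum_j z k j * p j = 0.
  by rewrite zz pp' qp mulr0 subr0 divfK // subrr.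
have zq k : \sum_j z k j * q j = 0.
  by rewrite zz qq' -/c mulr0 subr0 divfK // subrr.
have zk k : \sum_j z k j ^+ 2 = 1 - p k * q k / c *+ 2.
  rewrite (eq_bigr (fun j => z k j * z k j)) // zz.
  rewrite [\sum_j p j * _](eq_bigr (fun j => z k j * p j)) => [|j _]; last by rewrite mulrC.
  rewrite [\sum_j q j * _](eq_bigr (fun j => z k j * q j)) => [|j _]; last by rewrite mulrC.
  by rewrite zp zq !mulr0 !subr0 /z eqxx mulr2n [_ / c * _]mulrAC [p k / c * _]mulrAC [q k * _]mulrC opprD addrA.
(* The numbers [z k . z k] add up to [n - 2], the trace of the projection, so they are not all zero
   once [n] exceeds 2; a non-isotropic [z k] can then be rescaled. *)
have [k zk0] : exists k, \sum_j z k j ^+ 2 != 0.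
  apply/existsP; apply: contraT; rewrite negb_exists => /forallP no.
  have : \sum_k \sum_j z k j ^+ 2 = 0.
    by apply: big1 => k _; apply/eqP; have := no k; rewrite negbK.
  rewrite (eq_bigr _ (fun k _ => zk k)) sumrB sumr_const card_ord sumrMnl -mulr_suml -/c divff //.
  move/eqP; rewrite subr_eq0 eqr_nat => /eqP n2E; by rewrite n2E in n2.
pose r := sqrtC (- c *+ 2 / \sum_j z k j ^+ 2).
exists (fun j => r * z k j); split.
- by under eq_bigr do rewrite -mulrA; rewrite -mulr_sumr zp mulr0.
- by under eq_bigr do rewrite -mulrA; rewrite -mulr_sumr zq mulr0.
- by under eq_bigr do rewrite exprMn; rewrite -mulr_sumr sqrtCK divfK.
Qed.

Section Cone.
Variables (R : realType) (n : nat).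
Implicit Types (f : {mpoly R[i][n]}) (W : set 'rV[R[i]]_n).

Lemma vanish_on_cone f W : (2 < n)%N -> relatively_open (@isotropic_cone R n) W -> W !=set0 ->
  (forall rho, W rho -> f.@[fun j => rho 0 j] = 0) ->
  forall v, (quadric n R[i]).@[v] = 0 -> f.@[v] = 0.
Proof.
move=> n2 oW [rho Wrho] f0 q; rewrite meval_quadric => qq.
have pp : \sum_j rho 0 j ^+ 2 = 0 by case: oW Wrho => U _ -> [].
have [y [yp yq yy]] := isotropic_joining n2 pp qq.
(* The conic passes through [rho] at 0 and through [q] at 1. *)
pose c j : {poly R[i]} := (1 - 'X) ^+ 2 * (rho 0 j)%:P + 'X * (1 - 'X) * (y j)%:P + 'X ^+ 2 * (q j)%:P.
have cE j t : (c j).[t] = (1 - t) ^+ 2 * rho 0 j + t * (1 - t) * y j + t ^+ 2 * q j.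
  by rewrite /c !hornerE.
rewrite (_ : f.@[q] = f.@[fun j => (c j).[1]]); last first.
  by apply: meval_eq => j; rewrite cE; ring.
apply: (vanish_on_curve oW _ _ f0).
  rewrite (_ : \row_j _ = rho) //; apply/rowP => j; rewrite mxE cE; ring.
move=> t; rewrite /isotropic_cone /=.
under eq_bigr do rewrite mxE cE.
rewrite (eq_bigr (fun j => (1 - t) ^+ 4 * rho 0 j ^+ 2 + t ^+ 4 * q j ^+ 2
   + t ^+ 2 * (1 - t) ^+ 2 * (y j ^+ 2 + (rho 0 j * q j) *+ 2)
   + (1 - t) ^+ 3 * t *+ 2 * (y j * rho 0 j) + t ^+ 3 * (1 - t) *+ 2 * (y j * q j))); last first.
  by move=> j _; ring.
rewrite !big_split /= -!mulr_sumr pp qq yp yq !mulr0 !addr0 add0r big_split /= yy sumrMnl.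
by rewrite mulNrn addNr mulr0.
Qed.

Lemma vanish_on_line f W s : relatively_open (@coordinate_line R n s) W -> W !=set0 ->
  (forall rho, W rho -> f.@[fun j => rho 0 j] = 0) ->
  forall v : 'I_n -> R[i], coordinate_line s (\row_j v j) -> f.@[v] = 0.
Proof.
move=> oW [rho Wrho] f0 q qs.
have ps : coordinate_line s rho by case: oW Wrho => U _ -> [].
pose c j : {poly R[i]} := (1 - 'X) * (rho 0 j)%:P + 'X * (q j)%:P.
have cE j t : (c j).[t] = (1 - t) * rho 0 j + t * q j by rewrite /c !hornerE.
rewrite (_ : f.@[q] = f.@[fun j => (c j).[1]]); last first.
  by apply: meval_eq => j; rewrite cE; ring.
apply: (vanish_on_curve oW _ _ f0).
  rewrite (_ : \row_j _ = rho) //; apply/rowP => j; rewrite mxE cE; ring.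
move=> t i k i0 k1; rewrite !mxE !cE (ps i k) //.
by have := qs i k i0 k1; rewrite !mxE => ->; ring.
Qed.

End Cone.

(** * Complex-valued integrals *)

Section ReIm.
Variable R : realType.
Implicit Types x y : R[i].
Lemma cReD x y : complex.Re (x + y) = complex.Re x + complex.Re y.
Proof. by case: x y => [a b] [c d]. Qed.
Lemma cImD x y : complex.Im (x + y) = complex.Im x + complex.Im y.
Proof. by case: x y => [a b] [c d]. Qed.
Lemma cReM x y : complex.Re (x * y) =
  complex.Re x * complex.Re y - complex.Im x * complex.Im y.
Proof. by case: x y => [a b] [c d]. Qed.
Lemma cImM x y : complex.Im (x * y) =
  complex.Re x * complex.Im y + complex.Im x * complex.Re y.
Proof. by case: x y => [a b] [c d]. Qed.

Lemma cexpD x y : cexp (x + y) = cexp x * cexp y.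
Proof.
rewrite /cexp cReD cImD expRD cosD sinD; apply/eqP.
by rewrite eq_complex /=; apply/andP; split; apply/eqP; ring.
Qed.

Lemma cexp0 : cexp (0 : R[i]) = 1.
Proof. by rewrite /cexp /= expR0 cos0 sin0 mul1r mulr0. Qed.
End ReIm.

Section ComplexIntegral.
Context d (T : measurableType d) (R : realType).
Variable mu : {measure set T -> \bar R}.
Implicit Types (D : set T) (f g : T -> R[i]).

Definition has_cintegral D f (I : R[i]) := cintegrable mu D f /\ cintegral mu D f = I.

Lemma eq_has_cintegral D f g I : measurable D -> (forall x, D x -> f x = g x) ->
  has_cintegral D f I -> has_cintegral D g I.
Proof.
move=> mD fg [[iR iI] <-]; split; first split.
- by apply: eq_integrable iR => // x /set_mem /fg ->.
- by apply: eq_integrable iI => // x /set_mem /fg ->.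
- by congr (_ +i* _); apply: eq_Rintegral => x /set_mem /fg ->.
Qed.

Lemma has_cintegralD D f g I J : measurable D ->
  has_cintegral D f I -> has_cintegral D g J ->
  has_cintegral D (fun x => f x + g x) (I + J).
Proof.
move=> mD [[fR fI] <-] [[gR gI] <-]; split; first split.
- apply: eq_integrable (integrableD mD fR gR) => // x _ /=.
  by rewrite cReD EFinD.
- apply: eq_integrable (integrableD mD fI gI) => // x _ /=.
  by rewrite cImD EFinD.
- rewrite /cintegral.
  under eq_Rintegral do rewrite cReD.
  under [in X in _ +i* X]eq_Rintegral do rewrite cImD.
  by rewrite !RintegralD.
Qed.

Lemma has_cintegralZ D f I c : measurable D ->
  has_cintegral D f I -> has_cintegral D (fun x => c * f x) (c * I).
Proof.
move=> mD [[fR fI] <-]; case: c => a b; split; first split.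
- apply: eq_integrable (integrableB mD (integrableZl mD a fR) (integrableZl mD b fI)) => // x _ /=.
  by rewrite cReM /= EFinB !EFinM.
- apply: eq_integrable (integrableD mD (integrableZl mD a fI) (integrableZl mD b fR)) => // x _ /=.
  by rewrite cImM /= EFinD !EFinM.
- have iZ (h : T -> R) e : mu.-integrable D (fun x => (h x)%:E) ->
      mu.-integrable D (EFin \o (fun x => e * h x)).
    move=> hi; apply: eq_integrable (integrableZl mD e hi) => // x _ /=; by rewrite EFinM.
  rewrite /cintegral.
  under eq_Rintegral do rewrite cReM.
  under [in X in _ +i* X]eq_Rintegral do rewrite cImM.
  rewrite RintegralB ?RintegralD ?RintegralZl //; exact: iZ.
Qed.

Lemma has_cintegral0 D : has_cintegral D (fun=> 0) 0.
Proof.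
split; first by split; exact: integrable0.
by rewrite /cintegral /Rintegral /= integral0.
Qed.

Lemma has_cintegral_sum (I : Type) (r : seq I) D (F : I -> T -> R[i]) (J : I -> R[i]) :
  measurable D -> (forall i, has_cintegral D (F i) (J i)) ->
  has_cintegral D (fun x => \sum_(i <- r) F i x) (\sum_(i <- r) J i).
Proof.
move=> mD FJ; elim: r => [|i r IH].
  rewrite big_nil; apply: (eq_has_cintegral mD) (has_cintegral0 D) => x _.
  by rewrite big_nil.
rewrite big_cons; apply: (eq_has_cintegral mD) (has_cintegralD mD (FJ i) IH) => x _.
by rewrite big_cons.
Qed.

(** Extension by zero replaces the orthant by the whole space, where integrands that are products of
    one-variable functions can be integrated factor by factor. *)
Lemma has_cintegral_mkcond D f I : measurable D ->
  has_cintegral D f I <-> has_cintegral setT (fun x => if x \in D then f x else 0) I.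
Proof.
move=> mD.
have iE (p : R[i] -> R) : p 0 = 0 ->
    mu.-integrable setT (fun x => (p (if x \in D then f x else 0))%:E) =
    mu.-integrable D (fun x => (p (f x))%:E).
  move=> p0; rewrite (_ : (fun x => _) = (fun x => (p (f x))%:E) \_ D).
    by apply/idP/idP => /(integrable_mkcond _ mD).
  by apply/funext => x; rewrite /patch; case: ifP => // _; rewrite p0.
have rE (p : R[i] -> R) : p 0 = 0 ->
    \int[mu]_x p (if x \in D then f x else 0) = \int[mu]_(x in D) p (f x).
  move=> p0; rewrite [RHS]Rintegral_mkcond; apply: eq_Rintegral => x _.
  by rewrite /patch; case: ifP => // _; rewrite p0.
by rewrite /has_cintegral /cintegrable /cintegral !iE // !rE.
Qed.

End ComplexIntegral.

(** * Integrals over product measures and measure powers *)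

Section ProductIntegral.
Context d1 d2 (T1 : measurableType d1) (T2 : measurableType d2) (R : realType).
Variables (m1 : {sigma_finite_measure set T1 -> \bar R}).
Variables (m2 : {sigma_finite_measure set T2 -> \bar R}).
Variables (g : T1 -> R) (h : T2 -> R).
Hypotheses (ig : m1.-integrable setT (EFin \o g)) (ih : m2.-integrable setT (EFin \o h)).

Let gh : T1 * T2 -> \bar R := fun p => (g p.1 * h p.2)%:E.

Let mgh : measurable_fun setT gh.
Proof.
apply/measurable_EFinP; apply: measurable_funM.
- by apply: measurableT_comp; [exact/measurable_EFinP/measurable_int/ig|exact: measurable_fst].
- by apply: measurableT_comp; [exact/measurable_EFinP/measurable_int/ih|exact: measurable_snd].
Qed.

Let inner x : (\int[m2]_y gh (x, y) = ((Rintegral m2 setT h) * g x)%:E)%E.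
Proof.
rewrite /gh /=; under eq_integral do rewrite EFinM.
rewrite integralZl // EFinM muleC; congr (_ * _)%E.
by rewrite /Rintegral fineK //; exact: integrable_fin_num.
Qed.

(** Tonelli: the inner integral of the absolute value is a constant times [|g|]. *)
Lemma integrable_prod_mul : (m1 \x m2)%E.-integrable setT gh.
Proof.
apply/integrable12ltyP => //.
have habs : (\int[m2]_y `|h y|%:E < +oo)%E by have /integrableP[_] := ih.
have h0 : (0 <= \int[m2]_y `|h y|%:E)%E by apply: integral_ge0 => y _; rewrite lee_fin.
have -> : (fun x => \int[m2]_y `|gh (x, y)|)%E =
    (fun x => (fine (\int[m2]_y `|h y|%:E) * `|g x|)%:E)%E.
  apply/funext => x; rewrite /gh /=.
  under eq_integral do rewrite normrM EFinM.
  rewrite ge0_integralZl_EFin //; last first.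
  - by apply/measurable_EFinP/measurableT_comp => //; exact/measurable_EFinP/measurable_int/ih.
  - by rewrite EFinM fineK ?ge0_fin_numE // muleC.
have /integrableP[_] := integrableZl measurableT (fine (\int[m2]_y `|h y|%:E)%E) ig.
apply: le_lt_trans; rewrite le_eqVlt; apply/orP; left; apply/eqP.
apply: eq_integral => x _ /=; rewrite normrM; congr (_ * _)%:E.
by rewrite ger0_norm // fine_ge0.
Qed.

Lemma integral_prod_mul :
  (\int[m1 \x m2]_p gh p = (Rintegral m1 setT g * Rintegral m2 setT h)%:E)%E.
Proof.
rewrite -integral12_prod_meas1; last exact: integrable_prod_mul.
rewrite /fubini_F; under eq_integral do rewrite inner EFinM.
rewrite integralZl // EFinM muleC; congr (_ * _)%E.
by rewrite /Rintegral fineK //; exact: integrable_fin_num.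
Qed.

End ProductIntegral.

Section MeasureCons.
Context d (T : measurableType d) (R : realType) (n : nat).
Variables (m : {sigma_finite_measure set T -> \bar R}).
Variables (mu : {sigma_finite_measure set (n.-tuple T) -> \bar R}).

Lemma measure_cons_mul (g : T -> R) (h : n.-tuple T -> R) :
  m.-integrable setT (EFin \o g) -> mu.-integrable setT (EFin \o h) ->
  let gh := fun t : n.+1.-tuple T => g (thead t) * h [tuple of behead t] in
  (measure_cons m mu).-integrable setT (EFin \o gh) /\
  Rintegral (measure_cons m mu) setT gh = Rintegral m setT g * Rintegral mu setT h.
Proof.
move=> ig ih gh.
have E : (EFin \o gh) \o (@cons_pair _ T n) = (fun p => (g p.1 * h p.2)%:E).
  apply/funext => -[x t] /=; rewrite /gh theadE; congr (_ * h _)%:E.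
  exact/val_inj.
have mgh : measurable_fun setT (EFin \o gh).
  apply/measurable_EFinP; apply: measurable_funM; apply: measurableT_comp.
  - exact/measurable_EFinP/measurable_int/ig.
  - exact: measurable_tnth.
  - exact/measurable_EFinP/measurable_int/ih.
  - exact: measurable_behead.
have igh := integrable_prod_mul ig ih.
have iE : (m \x mu)%E.-integrable ((@cons_pair _ T n) @^-1` setT) ((EFin \o gh) \o (@cons_pair _ T n)).
  by rewrite E preimage_setT.
split; first exact: (integrable_pushforward (measurable_cons_pair (n := n)) mgh iE).
rewrite /Rintegral (integral_pushforward (measurable_cons_pair (n := n)) mgh iE) //.
by rewrite preimage_setT E integral_prod_mul.
Qed.

(** The real and imaginary parts of the product combine four real products, each covered by
    [measure_cons_mul]. *)
Lemma has_cintegral_measure_cons (g : T -> R[i]) (h : n.-tuple T -> R[i]) I J :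
  has_cintegral m setT g I -> has_cintegral mu setT h J ->
  has_cintegral (measure_cons m mu) setT
    (fun t => g (thead t) * h [tuple of behead t]) (I * J).
Proof.
move=> [[gR gI] <-] [[hR hI] <-].
have [iRR RR] := measure_cons_mul gR hR; have [iII II] := measure_cons_mul gI hI.
have [iRI RI] := measure_cons_mul gR hI; have [iIR IR] := measure_cons_mul gI hR.
split; first split.
- apply: eq_integrable (integrableB measurableT iRR iII) => // x _.
  by rewrite cReM EFinB.
- apply: eq_integrable (integrableD measurableT iRI iIR) => // x _.
  by rewrite cImM EFinD.
rewrite /cintegral.
under eq_Rintegral do rewrite cReM.
under [in X in _ +i* X]eq_Rintegral do rewrite cImM.
by rewrite RintegralB ?RintegralD // RR II RI IR.
Qed.

End MeasureCons.

Lemma has_cintegral_measure_power d (T : measurableType d) (R : realType)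
    (m : {sigma_finite_measure set T -> \bar R}) n (f : 'I_n -> T -> R[i]) I :
  (forall j, has_cintegral m setT (f j) (I j)) ->
  has_cintegral (measure_power m n) setT (fun t => \prod_j f j (tnth t j)) (\prod_j I j).
Proof.
elim: n f I => [|n IH] f I fI.
  have one (x : R[i]) : \prod_(j < 0) (fun=> x) j = 1 by rewrite big_ord0.
  apply: (@eq_has_cintegral _ _ _ _ _ (fun=> 1)) => //.
    by move=> t _; rewrite big_ord0.
  rewrite big_ord0; split; first split.
  - exact: finite_measure_integrable_cst.
  - exact: finite_measure_integrable_cst.
  - by rewrite /cintegral /Rintegral /= !integral_dirac // !diracT !mul1e.
apply: (@eq_has_cintegral _ _ _ _ _ (fun t => f ord0 (thead t) *
  \prod_(j < n) f (lift ord0 j) (tnth [tuple of behead t] j))) => //.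
  move=> t _; rewrite big_ord_recl; congr (_ * _); apply: eq_bigr => j _.
  by rewrite tnth_behead (_ : inord _ = lift ord0 j) //; apply/val_inj; rewrite /= inordK // ltnS.
rewrite big_ord_recl.
exact: (has_cintegral_measure_cons (fI ord0)
  (IH (fun j => f (lift ord0 j)) (fun j => I (lift ord0 j)) (fun j => fI (lift ord0 j)))).
Qed.

(** * One-dimensional Laplace transforms *)

Section DominatedFTC.
Variable R : realType.
Implicit Types f g F G : R -> R.
Let mu := @lebesgue_measure R.

Let is_derive_continuous f (f' : R -> R) : (forall x : R, is_derive x (1 : R) f (f' x)) -> continuous f.
Proof.
move=> df x; apply/differentiable_continuous/derivable1_diffP.
by have [] := df x.
Qed.

(** For a nonnegative integrand the fundamental theorem gives a finite integral, and with it
    integrability. *)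
Let ge0_FTC f F (l : R) : (forall x, 0 <= x -> 0 <= f x) -> continuous f ->
  (forall x : R, is_derive x (1 : R) F (f x)) -> F x @[x --> +oo%R] --> l ->
  mu.-integrable `[0, +oo[ (EFin \o f) /\ \int[mu]_(x in `[0, +oo[) f x = l - F 0.
Proof.
move=> f0 cf dF Fl.
have cF := is_derive_continuous dF.
have E : (\int[mu]_(x in `[0%R, +oo[) (f x)%:E = l%:E - (F 0)%:E)%E.
  apply: ge0_continuous_FTC2y.
  - exact: f0.
  - exact: continuous_subspaceT.
  - exact: Fl.
  - by move=> x _; have [] := dF x.
  - exact: (cvg_at_right_filter (cF 0)).
  - by move=> x _; rewrite derive1E; have [_ ->] := dF x.
split; last by rewrite /Rintegral E.
apply/integrableP; split.
  by apply/measurable_EFinP/measurable_funTS; exact: continuous_measurable_fun.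
have -> : (\int[mu]_(x in `[0%R, +oo[) `|(EFin \o f) x| = \int[mu]_(x in `[0%R, +oo[) (f x)%:E)%E.
  apply: eq_integral => x /set_mem /=.
  by rewrite in_itv /= andbT => x0; rewrite ger0_norm ?f0.
by rewrite E ltry.
Qed.

(* Splitting f = (f + g) - g reduces to nonnegative integrands. *)
Lemma dominated_FTC2y f g F G (lF lG : R) : (forall x, 0 <= x -> `|f x| <= g x) ->
  continuous f -> continuous g ->
  (forall x : R, is_derive x (1 : R) F (f x)) -> (forall x : R, is_derive x (1 : R) G (g x)) ->
  F x @[x --> +oo%R] --> lF -> G x @[x --> +oo%R] --> lG ->
  mu.-integrable `]0, +oo[ (EFin \o f) /\ \int[mu]_(x in `]0, +oo[) f x = lF - F 0.
Proof.
move=> fg cf cg dF dG Fl Gl.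
have g0 x : 0 <= x -> 0 <= g x by move=> /fg; apply: le_trans.
have [ig Ig] := ge0_FTC g0 cg dG Gl.
have fg0 x : 0 <= x -> 0 <= f x + g x.
  by move=> /fg; rewrite ler_norml => /andP[h _]; rewrite -(opprK (g x)) subr_ge0.
have cfg : continuous (fun x => f x + g x) by move=> x; apply: cvgD; [exact: cf|exact: cg].
have dFG x : is_derive x (1 : R) (fun x => F x + G x) (f x + g x) by exact: is_deriveD.
have [ifg Ifg] := ge0_FTC fg0 cfg dFG (cvgD Fl Gl).
have m0 : measurable (`[0, +oo[%classic : set (measurableTypeR R)) by exact: measurable_itv.
have if_ : mu.-integrable `[0, +oo[ (EFin \o f).
  apply: eq_integrable (integrableB m0 ifg ig) => // x _ /=.
  by rewrite -EFinB addrK.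
have io : mu.-integrable `]0, +oo[ (EFin \o f).
  apply: integrableS if_ => // x /=; rewrite !in_itv /= !andbT; exact: ltW.
split=> //; rewrite Rintegral_itv_obnd_cbnd //.
have : \int[mu]_(x in `[0, +oo[) f x + (lG - G 0) = lF + lG - (F 0 + G 0).
  by rewrite -Ig -Ifg RintegralD.
by move=> h; lra.
Qed.

End DominatedFTC.

Section ComplexDerivative.
Variable R : realType.
Implicit Types (f g : R -> R[i]).

Definition cderiv f f' := forall x : R,
  is_derive x (1 : R) (fun x => complex.Re (f x)) (complex.Re (f' x)) /\
  is_derive x (1 : R) (fun x => complex.Im (f x)) (complex.Im (f' x)).

Definition cvanish f :=
  complex.Re (f x) @[x --> +oo%R] --> (0 : R) /\ complex.Im (f x) @[x --> +oo%R] --> (0 : R).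

Lemma cderivD f g f' g' : cderiv f f' -> cderiv g g' ->
  cderiv (fun x => f x + g x) (fun x => f' x + g' x).
Proof.
move=> df dg x; have [? ?] := df x; have [? ?] := dg x.
split.
- by under eq_fun do rewrite cReD; rewrite cReD; exact: is_deriveD.
- by under eq_fun do rewrite cImD; rewrite cImD; exact: is_deriveD.
Qed.

Lemma cderivM f g f' g' : cderiv f f' -> cderiv g g' ->
  cderiv (fun x => f x * g x) (fun x => f' x * g x + f x * g' x).
Proof.
move=> df dg x; have [? ?] := df x; have [? ?] := dg x.
split.
- under eq_fun do rewrite cReM; rewrite cReD !cReM; apply: is_derive_eq.
  by rewrite /GRing.scale /=; ring.
- under eq_fun do rewrite cImM; rewrite cImD !cImM; apply: is_derive_eq.
  by rewrite /GRing.scale /=; ring.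
Qed.

Lemma cderiv_cst (c : R[i]) : cderiv (fun=> c) (fun=> 0).
Proof. by move=> x; split => /=; exact: is_derive_cst. Qed.

Lemma cderivZ f f' c : cderiv f f' -> cderiv (fun x => c * f x) (fun x => c * f' x).
Proof.
move=> df x; have := cderivM (cderiv_cst c) df x.
by rewrite mul0r add0r.
Qed.

Lemma cderiv_real (p p' : R -> R) : (forall x : R, is_derive x (1 : R) p (p' x)) ->
  cderiv (fun x => (p x)%:C) (fun x => (p' x)%:C).
Proof. by move=> dp x; split => //=; exact: is_derive_cst. Qed.

Lemma cvanishD f g : cvanish f -> cvanish g -> cvanish (fun x => f x + g x).
Proof.
move=> [fR fI] [gR gI]; split.
- under eq_fun do rewrite cReD.
  by have := cvgD fR gR; rewrite addr0 => h; exact: h.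
- under eq_fun do rewrite cImD.
  by have := cvgD fI gI; rewrite addr0 => h; exact: h.
Qed.

Lemma cvanishZ f c : cvanish f -> cvanish (fun x => c * f x).
Proof.
move=> [fR fI]; split.
- under eq_fun do rewrite cReM.
  have := cvgB (cvgMl_tmp (a := complex.Re c) fR) (cvgMl_tmp (a := complex.Im c) fI).
  by rewrite !mulr0 subr0 => h; exact: h.
- under eq_fun do rewrite cImM.
  have := cvgD (cvgMl_tmp (a := complex.Re c) fI) (cvgMl_tmp (a := complex.Im c) fR).
  by rewrite !mulr0 addr0 => h; exact: h.
Qed.

Lemma cderiv_continuous f f' : cderiv f f' ->
  continuous (fun x => complex.Re (f x)) /\ continuous (fun x => complex.Im (f x)).
Proof.
move=> df; split=> x; apply/differentiable_continuous/derivable1_diffP;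
  by have [[? ?] [? ?]] := df x.
Qed.

(** The exponential series gives exp(xa) >= (xa)^(k+1) / (k+1)!, so x^k exp(-xa) is at most
    [C / x]. *)
Lemma exp_dominates (a : R) k : 0 < a -> x ^+ k * expR (- (x * a)) @[x --> +oo%R] --> (0 : R).
Proof.
move=> a0; pose C := k.+1`!%:R / a ^+ k.+1.
have C0 : 0 < C by rewrite divr_gt0 ?exprn_gt0 // ltr0n fact_gt0.
have bound x : 0 <= x -> x ^+ k.+1 * expR (- (x * a)) <= C.
  move=> x0; rewrite expRN ler_pdivrMr ?expR_gt0 // mulrC.
  have xa0 : 0 <= x * a by rewrite mulr_ge0 // ltW.
  have := expR_ge1Dxn k xa0; move=> h.
  have {}h : (x * a) ^+ k.+1 / k.+1`!%:R <= expR (x * a).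
    by apply: le_trans h; rewrite lerDr.
  rewrite -ler_pdivrMr //; apply: le_trans h; rewrite exprMn /C invf_div.
  by rewrite mulrA.
apply/cvgrPdist_le => e e0; near=> x.
have x0 : 0 < x by near: x; apply: nbhs_pinfty_gt; exact: num_real.
have xC : C / e <= x by near: x; apply: nbhs_pinfty_ge; exact: num_real.
rewrite sub0r normrN ger0_norm ?mulr_ge0 ?exprn_ge0 ?expR_ge0 ?(ltW x0) //.
rewrite -(ler_pM2l x0) mulrA -exprS; apply: le_trans (bound _ (ltW x0)) _.
by rewrite -ler_pdivrMr.
Unshelve. all: by end_near. Qed.

End ComplexDerivative.

Section LaplaceMonomial.
Variable R : realType.
Implicit Types (rho : R[i]) (k : nat).

Definition laplace_kernel rho k (x : R) : R[i] := x%:C ^+ k * cexp (- (x%:C * rho)).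

(** The antiderivative of the kernel obtained by repeated integration by parts. *)
Fixpoint laplace_primitive rho k (x : R) : R[i] :=
  - rho^-1 * laplace_kernel rho k x +
  (if k is l.+1 then (k%:R / rho) * laplace_primitive rho l x else 0).

Let kernelE rho k x : laplace_kernel rho k x =
  (x ^+ k * expR (- (x * complex.Re rho)) * cos (x * complex.Im rho))
  +i* - (x ^+ k * expR (- (x * complex.Re rho)) * sin (x * complex.Im rho)).
Proof.
rewrite /laplace_kernel -rmorphXn /cexp; case: rho => a b /=.
rewrite !mul0r !subr0 !addr0 cosN sinN; apply/eqP; rewrite eq_complex /=.
by apply/andP; split; apply/eqP; ring.
Qed.

Lemma cderiv_cexp rho : cderiv (fun x : R => cexp (- (x%:C * rho)))
  (fun x => - rho * cexp (- (x%:C * rho))).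
Proof.
case: rho => a b x; split.
- rewrite (_ : (fun x => _) = (fun x => expR (- (x * a)) * cos (- (x * b)))); last first.
    by apply/funext => y; rewrite /cexp /= !mul0r !subr0 !addr0.
  apply: is_derive_eq; rewrite /cexp /= !mul0r !subr0 !addr0 /GRing.scale /=; ring.
- rewrite (_ : (fun x => _) = (fun x => expR (- (x * a)) * sin (- (x * b)))); last first.
    by apply/funext => y; rewrite /cexp /= !mul0r !subr0 !addr0.
  apply: is_derive_eq; rewrite /cexp /= !mul0r !subr0 !addr0 /GRing.scale /=; ring.
Qed.

Lemma cderiv_kernel rho k : cderiv (laplace_kernel rho k)
  (fun x => (k%:R * x ^+ k.-1)%:C * cexp (- (x%:C * rho)) + x%:C ^+ k * (- rho * cexp (- (x%:C * rho)))).
Proof.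
have dX (x : R) : is_derive x (1 : R) (fun x : R => x ^+ k) (k%:R * x ^+ k.-1).
  have := is_deriveX k (is_derive_id x (1 : R)).
  rewrite /GRing.scale /= mulr1 (_ : id ^+ k = fun x : R => x ^+ k) //.
  apply/funext => y; elim: k => [|l IH] /=; by rewrite ?expr0 // !exprS -IH.
have := cderivM (cderiv_real dX) (cderiv_cexp rho).
rewrite (_ : (fun x => (x ^+ k)%:C * _) = laplace_kernel rho k).
  by move=> h x; rewrite -rmorphXn; exact: h.
by apply/funext => x; rewrite /laplace_kernel rmorphXn.
Qed.

Lemma cderiv_primitive rho k : rho != 0 ->
  cderiv (laplace_primitive rho k) (laplace_kernel rho k).
Proof.
move=> rho0; elim: k => [|k IH].
  have := cderivD (cderivZ (- rho^-1) (cderiv_kernel rho 0)) (cderiv_cst 0).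
  rewrite (_ : (fun x => _ * (_ + _) + 0) = laplace_kernel rho 0) //.
  apply/funext => x; rewrite /laplace_kernel mul0r /= mul0r add0r addr0 !expr0 !mul1r.
  by rewrite mulrA mulrNN mulVf // mul1r.
have := cderivD (cderivZ (- rho^-1) (cderiv_kernel rho k.+1)) (cderivZ (k.+1%:R / rho) IH).
rewrite (_ : (fun x => _ * (_ + _) + _) = laplace_kernel rho k.+1) //.
apply/funext => x; rewrite /laplace_kernel /= rmorphM rmorph_nat rmorphXn /=.
set e := cexp _; rewrite exprS; field; exact: rho0.
Qed.

Lemma cvanish_kernel rho k : 0 < complex.Re rho -> cvanish (laplace_kernel rho k).
Proof.
move=> a0; have ed := exp_dominates k a0.
have sq (u v : R -> R) : (forall x, `|v x| <= 1) -> u x @[x --> +oo%R] --> (0 : R) ->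
    u x * v x @[x --> +oo%R] --> (0 : R).
  move=> v1 /cvgrPdist_le u0; apply/cvgrPdist_le => e e0; near=> x.
  have : `|0 - u x| <= e by near: x; exact: u0.
  rewrite !sub0r !normrN normrM; apply: le_trans.
  by rewrite ler_piMr.
split; under eq_fun do rewrite kernelE /=.
- by apply: sq => // x; rewrite ler_norml cos_geN1 cos_le1.
- have s1 (x : R) : `|sin (x * complex.Im rho)| <= 1 by rewrite ler_norml sin_geN1 sin_le1.
  by have := cvgN (sq _ _ s1 ed); rewrite oppr0 => h; exact: h.
Unshelve. all: by end_near. Qed.

Lemma cvanish_primitive rho k : 0 < complex.Re rho -> cvanish (laplace_primitive rho k).
Proof.
move=> a0; elim: k => [|k IH].
  apply: cvanishD; first exact/cvanishZ/cvanish_kernel.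
  by split; exact: cvg_cst.
apply: cvanishD; first exact/cvanishZ/cvanish_kernel.
exact: cvanishZ.
Qed.

(** At 0 every kernel with positive exponent vanishes, so only the innermost term of the recursion
    contributes, times the accumulated factors. *)
Lemma laplace_primitive0 rho k : rho != 0 ->
  laplace_primitive rho k 0 = - (k`!%:R / rho ^+ k.+1).
Proof.
move=> rho0; elim: k => [|k IH].
  by rewrite /= /laplace_kernel expr0 mul0r oppr0 cexp0 addr0 !mulr1 fact0 mul1r expr1.
rewrite /= IH /laplace_kernel expr0n mul0r mulr0 add0r factS natrM [rho ^+ k.+2]exprS.
by rewrite invfM; ring.
Qed.

Lemma has_cintegral_kernel rho k : 0 < complex.Re rho ->
  has_cintegral (@lebesgue_measure R) `]0, +oo[%classic (laplace_kernel rho k)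
    (k`!%:R / rho ^+ k.+1).
Proof.
(* The majorant is the kernel with the real parameter [a], whose primitive is known by the same
   lemmas. *)
move=> a0; pose a := (complex.Re rho)%:C.
have ra0 : 0 < complex.Re a by [].
have rho0 : rho != 0 by apply: contraTneq a0 => ->; rewrite ltxx.
have aN0 : a != 0 by apply: contraTneq ra0 => ->; rewrite ltxx.
have [cR cI] := cderiv_continuous (cderiv_kernel rho k).
have [caR _] := cderiv_continuous (cderiv_kernel a k).
have [vR vI] := cvanish_primitive k a0; have [vaR _] := cvanish_primitive k ra0.
have dR x := (cderiv_primitive k rho0 x).1.
have dI x := (cderiv_primitive k rho0 x).2.
have daR x := (cderiv_primitive k aN0 x).1.
have bnd (x v : R) : 0 <= x -> `|v| <= 1 ->
    `|x ^+ k * expR (- (x * complex.Re rho)) * v| <= complex.Re (laplace_kernel a k x).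
  move=> x0 v1; rewrite kernelE /= mulr0 cos0 mulr1 normrM.
  rewrite [X in X * _]ger0_norm ?mulr_ge0 ?exprn_ge0 ?expR_ge0 // ler_piMr //.
  by rewrite mulr_ge0 ?exprn_ge0 ?expR_ge0.
have hR x : 0 <= x ->
    `|complex.Re (laplace_kernel rho k x)| <= complex.Re (laplace_kernel a k x).
  by move=> x0; rewrite kernelE; apply: bnd => //; rewrite ler_norml cos_geN1 cos_le1.
have hI x : 0 <= x ->
    `|complex.Im (laplace_kernel rho k x)| <= complex.Re (laplace_kernel a k x).
  move=> x0; rewrite kernelE /= normrN; apply: bnd => //.
  by rewrite ler_norml sin_geN1 sin_le1.
have [iR IR] := dominated_FTC2y hR cR caR dR daR vR vaR.
have [iI II] := dominated_FTC2y hI cI caR dI daR vI vaR.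
split=> //; rewrite /cintegral IR II !sub0r laplace_primitive0 //.
by case: (_ / _) => u v; rewrite /= !opprK.
Qed.

End LaplaceMonomial.

(** * The Laplace transform of a polynomial *)

(** In two variables the quadric factors into the two linear forms that define the lines. *)
Lemma vanish_on_two_lines (R : realType) (f : {mpoly R[i][2]}) (W1 W2 : set 'rV[R[i]]_2) :
  relatively_open (@coordinate_line R 2 'i%C) W1 -> W1 !=set0 ->
  relatively_open (@coordinate_line R 2 (- 'i%C)) W2 -> W2 !=set0 ->
  (forall rho, W1 rho -> f.@[fun j => rho 0 j] = 0) ->
  (forall rho, W2 rho -> f.@[fun j => rho 0 j] = 0) ->
  forall v, (quadric 2 R[i]).@[v] = 0 -> f.@[v] = 0.
Proof.
move=> oW1 W1n oW2 W2n f1 f2 v.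
have line s : v ord0 = s * v ord_max -> coordinate_line s (\row_j v j).
  move=> vs j k j0 k1; rewrite !mxE.
  have -> : j = ord0 by exact: val_inj.
  have -> : k = ord_max by exact: val_inj.
  exact: vs.
rewrite meval_quadric big_ord_recl big_ord1 (_ : lift ord0 ord0 = ord_max); last exact/val_inj.
have -> : v ord0 ^+ 2 + v ord_max ^+ 2 =
    (v ord0 - 'i%C * v ord_max) * (v ord0 - - 'i%C * v ord_max).
  have := sqr_i R; set i := 'i%C => i2.
  have -> : (v ord0 - i * v ord_max) * (v ord0 - - i * v ord_max) =
    v ord0 ^+ 2 - i ^+ 2 * v ord_max ^+ 2 by ring.
  by rewrite i2 mulN1r opprK.
move/eqP; rewrite mulf_eq0 !subr_eq0 => /orP[] /eqP /line vl.
- exact: (vanish_on_line oW1 W1n f1).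
- exact: (vanish_on_line oW2 W2n f2).
Qed.

Section LaplaceTransform.
Variables (R : realType) (n : nat).
Implicit Types (P : {mpoly R[i][n]}) (rho : 'rV[R[i]]_n).

Definition laplace_poly P : {mpoly R[i][n]} :=
  \sum_(m <- msupp P) (P@_m * (mfact m)%:R) *: 'X_[m + mconst n 1].

Lemma laplace_poly_homog N P : P \is N.-homog -> laplace_poly P \is (N + n).-homog.
Proof.
move=> /dhomogP PN; rewrite /laplace_poly big_seq; apply: rpred_sum => m /PN mN.
apply: rpredZ; rewrite dhomogX /= mdegD mN eqn_add2l mdegE.
by rewrite (eq_bigr (fun=> 1%N)) ?sum1_card ?card_ord // => j _; rewrite mnmE.
Qed.

Lemma eval_inv_laplace_poly P rho : eval_inv (laplace_poly P) rho =
  \sum_(m <- msupp P) P@_m * (mfact m)%:R * \prod_j (rho 0 j)^-1 ^+ (m j).+1.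
Proof.
rewrite /eval_inv /laplace_poly raddf_sum; apply: eq_bigr => m _ /=.
rewrite mevalZ mevalX; congr (_ * _); apply: eq_bigr => j _.
by rewrite mnmDE mnmE addn1.
Qed.

Lemma measurable_positive_orthant : measurable (@positive_orthant R n).
Proof.
rewrite (_ : @positive_orthant R n = \bigcap_(j in [set: 'I_n])
    ((fun x : n.-tuple (measurableTypeR R) => tnth x j) @^-1` `]0, +oo[)).
  apply: fin_bigcap_measurable => // j _.
  rewrite -[X in measurable X]setTI; apply: measurable_tnth => //.
apply/seteqP; split=> x /=.
  by move=> x0 j _; rewrite /= in_itv /= andbT.
by move=> x0 j; have := x0 j I; rewrite /= in_itv /= andbT.
Qed.

Lemma laplace_integrandE P rho (x : n.-tuple (measurableTypeR R)) :
  laplace_integrand P rho x =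
  \sum_(m <- msupp P) P@_m * \prod_j laplace_kernel (rho 0 j) (m j) (tnth x j).
Proof.
rewrite /laplace_integrand mevalE mulr_sumr; apply: eq_bigr => m _.
rewrite mulrCA; congr (_ * _); rewrite -sumrN.
rewrite (big_morph _ (@cexpD R) (@cexp0 R)) -big_split; apply: eq_bigr => j _ /=.
by rewrite mulrC.
Qed.

Lemma has_cintegral_laplace P rho : (forall j, 0 < complex.Re (rho 0 j)) ->
  has_cintegral (lebesgue_measure_rn R n) (@positive_orthant R n)
    (laplace_integrand P rho) (eval_inv (laplace_poly P) rho).
Proof.
move=> rho0; apply: (has_cintegral_mkcond _ _ _ _).2; first exact: measurable_positive_orthant.
(* The indicator of the orthant is distributed over the coordinates, so that each monomial
   contributes a product of one-variable functions. *)
pose F m (x : n.-tuple (measurableTypeR R)) := \prod_j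
  (if tnth x j \in `]0, +oo[%classic
   then laplace_kernel (rho 0 j) (m j) (tnth x j) else 0).
have FI (m : 'X_{1..n}) : has_cintegral (lebesgue_measure_rn R n) setT (F m)
    (\prod_j ((m j)`!%:R / rho 0 j ^+ (m j).+1)).
  apply: (has_cintegral_measure_power (m := @lebesgue_measure R)
    (f := fun j x => if x \in `]0, +oo[%classic then laplace_kernel (rho 0 j) (m j) x else 0)) => j.
  apply: (has_cintegral_mkcond _ _ _ _).1; first exact: measurable_itv.
  exact: has_cintegral_kernel.
rewrite eval_inv_laplace_poly.
have := has_cintegral_sum (msupp P) measurableT
  (fun m => has_cintegralZ P@_m measurableT (FI m)).
rewrite (eq_bigr (fun m => P@_m * (mfact m)%:R * \prod_j (rho 0 j)^-1 ^+ (m j).+1)); last first.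
  move=> m _; rewrite -mulrA; congr (_ * _).
  rewrite big_split /= /mfact natr_prod; congr (_ * _).
  by apply: eq_bigr => j _; rewrite exprVn.
apply: eq_has_cintegral => // x _; rewrite laplace_integrandE.
case: ifPn => [/set_mem x0|/negP x0].
  apply: eq_bigr => m _; congr (_ * _); apply: eq_bigr => j _.
  by rewrite ifT // inE /= in_itv /= andbT; exact: x0.
rewrite big1 // => m _.
have [j xj] : exists j, ~~ (0 < tnth x j).
  apply/existsP; rewrite -negb_forall; apply/negP => /forallP h.
  by apply: x0; rewrite inE => j; exact: h.
rewrite /F (bigD1 j) //= ifF ?mul0r ?mulr0 //.
by apply/negbTE; rewrite notin_setE /= in_itv /= andbT; apply/negP.
Qed.

(** The exponents of [P] are at most [N], strictly below [N.+1], so [reciprocal N.+1 P] also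
    vanishes at the points with a zero coordinate; elsewhere it is the transform with denominators
    cleared. *)
Lemma vanishes_on_reciprocal N P (W : set 'rV[R[i]]_n) : P \is N.-homog ->
  vanishes_on (eval_inv (laplace_poly P)) W ->
  forall rho, W rho -> (reciprocal N.+1 P).@[fun j => rho 0 j] = 0.
Proof.
move=> /dhomogP PN W0 rho Wrho.
have mN m j : m \in msupp P -> (m j < N.+1)%N.
  by move=> /PN <-; rewrite ltnS /= mdegE (bigD1 j) //= leq_addr.
have [/forallP rho0|] := boolP [forall j, rho 0 j != 0].
  rewrite meval_reciprocal // -?eval_inv_laplace_poly ?W0 ?mulr0 //.
  by move=> m mP; apply/mnm_lepP => j; rewrite mnmE ltnW ?mN.
rewrite negb_forall => /existsP[j]; rewrite negbK => /eqP rhoj.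
by apply: (meval_reciprocal_eq0 (j := j)) => // m; exact: mN.
Qed.

End LaplaceTransform.

Lemma reciprocal_harmonic_vanish_cone (C : numClosedFieldType) n N (P : {mpoly C[n]}) :
  (1 < n)%N -> P \is N.-homog -> laplacian P = 0 ->
  (forall v, (quadric n C).@[v] = 0 -> (reciprocal N.+1 P).@[v] = 0) -> P = 0.
Proof.
move=> n1 PN LP /(quadric_dvd n1)[T PT].
apply: (harmonic_reciprocal_eq0 n1 PN _ LP PT) => m /(dhomogP _ _ _ PN) mN.
by apply/mnm_lepP => j; rewrite mnmE leqW // -mN /= mdegE (bigD1 j) //= leq_addr.
Qed.

Unset Implicit Arguments.

Theorem theorem3p5 (R : realType) (n N : nat) (hn : (2 <= n)%N)
    (P : {mpoly R[i][n]}) (P_neq0 : P != 0) (P_homog : P \is N.-homog)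
    (P_harmonic : harmonic_mpoly P) :
  exists Q : {mpoly R[i][n]},
    [/\ Q \is (N + n).-homog,
        forall rho : 'rV[R[i]]_n, (forall j, 0 < complex.Re (rho 0 j)) ->
          laplace_converges P rho /\ laplace P rho = eval_inv Q rho,
        (3 <= n)%N ->
          forall W : set 'rV[R[i]]_n,
            relatively_open (@isotropic_cone R n) W -> W !=set0 ->
            ~ vanishes_on (eval_inv Q) W
      & n = 2%N ->
          forall W1 W2 : set 'rV[R[i]]_n,
            relatively_open (@coordinate_line R n 'i%C) W1 -> W1 !=set0 ->
            relatively_open (@coordinate_line R n (- 'i%C)) W2 -> W2 !=set0 ->
            ~ (vanishes_on (eval_inv Q) W1 /\ vanishes_on (eval_inv Q) W2)].
Proof.
have P0 : (forall v, (quadric n R[i]).@[v] = 0 -> (reciprocal N.+1 P).@[v] = 0) -> False.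
  by move=> /(reciprocal_harmonic_vanish_cone hn P_homog P_harmonic)/eqP; exact/negP.
exists (laplace_poly P); split.
- exact: laplace_poly_homog.
- by move=> rho; exact: has_cintegral_laplace.
- move=> n3 W oW Wn /(vanishes_on_reciprocal P_homog) WP; apply: P0.
  exact: vanish_on_cone oW Wn WP.
- move=> n2; move: P P_homog P0 {P_neq0 P_harmonic hn}; rewrite n2 => P P_homog P0.
  move=> W1 W2 oW1 W1n oW2 W2n [/(vanishes_on_reciprocal P_homog) W1P].
  move=> /(vanishes_on_reciprocal P_homog) W2P; apply: P0.
  exact: vanish_on_two_lines oW1 W1n oW2 W2n W1P W2P.
Qed.
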